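(* Let $f\in C^2(\mathbb{R}^d,\mathbb{R}^d)$ and let $x(t)$, $t\ge0$, be a nonconstant bounded solution of $\dot x(t)=f(x(t))$. Let $V_0=\mathrm{span}(\dot x(0))$. Then there exist constants $C,h_0>0$ such that $$d_H\big(I_1^{\mathrm{diff}}(h,V_0),I_1^{\mathrm{cont}}(V_0)\big)\le C h\qquad\text{for all } 0<h\le h_0$$ holds for the Hausdorff distance $d_H$.
   Context: For nonzero vectors $v,w\in\mathbb{R}^d$, $\measuredangle(v,w)=\arccos\big(\frac{|v^\top w|}{\|v\|\|w\|}\big)\in[0,\frac\pi2]$ (the principal angle between $\mathrm{span}(v)$ and $\mathrm{span}(w)$). $P_V$ is the orthogonal projector onto a subspace $V$ and $\|\cdot\|$ the Euclidean/spectral norm. $\Phi(t,\tau)$ is the solution operator of the variational equation $\dot u(t)=A(t)u(t)$, $A(t)=Df(x(t))$, along the solution $x$. For $T>0$, $$\alpha_1^{\mathrm{cont}}(T,V_0)=\frac1T\int_0^T\big\|(I_d-P_{\Phi(t,0)V_0})A(t)P_{\Phi(t,0)V_0}\big\|\,dt,$$ $$\alpha_1^{\mathrm{diff}}(h,T,V_0)=\frac1T\sum_{j=1}^{N}\measuredangle\big(x((j-1)h)-x(jh),\ x(jh)-x((j+1)h)\big),\qquad h=\frac TN,\ N\in\mathbb{N}.$$ The angular ranges are $$I_1^{\mathrm{cont}}(V_0)=\Big[\varliminf_{T\to\infty}\alpha_1^{\mathrm{cont}}(T,V_0),\ \varlimsup_{T\to\infty}\alpha_1^{\mathrm{cont}}(T,V_0)\Big],\quad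 I_1^{\mathrm{diff}}(h,V_0)=\Big[\varliminf_{N\to\infty}\alpha_1^{\mathrm{diff}}(h,Nh,V_0),\ \varlimsup_{N\to\infty}\alpha_1^{\mathrm{diff}}(h,Nh,V_0)\Big].$$ *)

(* Defs.v *)
From mathcomp Require Import all_boot all_order all_algebra.
From mathcomp Require Import all_classical all_reals all_analysis.
Import Order.TTheory GRing.Theory Num.Theory.
Import numFieldNormedType.Exports.

Set Implicit Arguments.
Unset Strict Implicit.
Unset Printing Implicit Defensive.

Local Open Scope classical_set_scope.
Local Open Scope ring_scope.

(* The library norm on matrices is the sup norm, hence the separate Euclidean
   and spectral norms. *)
Definition eucl_norm {R : realType} {d : nat} (v : 'cV[R]_d) : R :=
  Num.sqrt (\sum_(i < d) v i ord0 ^+ 2).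

Definition spectral_norm {R : realType} {m n : nat} (M : 'M[R]_(m, n)) : R :=
  sup [set eucl_norm (M *m v) | v in [set v : 'cV[R]_n | eucl_norm v <= 1]].

(* Only meaningful for nonzero v and w; division by 0 yields 0, so the value is
   pi / 2 if v or w vanishes. *)
Definition angle {R : realType} {d : nat} (v w : 'cV[R]_d) : R :=
  acos (`|(v^T *m w) ord0 ord0| / (eucl_norm v * eucl_norm w)).

Definition basis_mx {R : realType} {d : nat} (V : {vspace 'cV[R]_d}) :
    'M[R]_(d, \dim V) :=
  \matrix_(i, j) (vbasis V)`_j i ord0.

(* B (B^T B)^-1 B^T for the matrix B whose columns are a basis of V; B has full
   column rank, so B^T B is invertible. *)
Definition orth_proj {R : realType} {d : nat} (V : {vspace 'cV[R]_d}) : 'M[R]_d :=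
  let B := basis_mx V in B *m invmx (B^T *m B) *m B^T.

Definition jac {R : realType} {d : nat} (f : 'cV[R]_d -> 'cV[R]_d)
    (p : 'cV[R]_d) : 'M[R]_d :=
  \matrix_(i, j) ('D_(delta_mx j ord0) f p) i ord0.

(* In finite dimension, continuity of p |-> D(Df)(p) as an operator-valued map
   is continuity of p |-> D(Df)(p)v for every direction v. *)
Definition class_C2 {R : realType} {d : nat} (f : 'cV[R]_d -> 'cV[R]_d) : Prop :=
  [/\ forall p, differentiable f p,
      forall p, differentiable (jac f) p
    & forall v, continuous (fun p => 'd (jac f) p v)].

(* Derivatives along the time axis [0, +oo[: one-sided at 0, and independent of
   the values taken at negative times. *)
Definition diff_quot {R : realType} {V : normedModType R} (u : R -> V) (t : R) :
    R -> V :=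
  fun s => (s - t)^-1 *: (u s - u t).

Definition punctured_nneg {R : realType} (t : R) : set_system R :=
  within [set s : R | 0 <= s] t^'.

Definition has_tderiv {R : realType} {V : normedModType R} (u : R -> V)
    (t : R) (l : V) : Prop :=
  diff_quot u t @ punctured_nneg t --> l.

Definition tderiv {R : realType} {V : normedModType R} (u : R -> V) (t : R) : V :=
  lim (diff_quot u t @ punctured_nneg t).

Definition ode_solution {R : realType} {d : nat} (f : 'cV[R]_d -> 'cV[R]_d)
    (x : R -> 'cV[R]_d) : Prop :=
  forall t, 0 <= t -> has_tderiv x t (f (x t)).

Definition bounded_traj {R : realType} {d : nat} (x : R -> 'cV[R]_d) : Prop :=
  exists M : R, forall t, 0 <= t -> eucl_norm (x t) <= M.

Definition nonconstant_traj {R : realType} {d : nat} (x : R -> 'cV[R]_d) : Prop :=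
  ~ exists c : 'cV[R]_d, forall t, 0 <= t -> x t = c.

Definition solution_operator {R : realType} {d : nat} (A : R -> 'M[R]_d)
    (Phi : R -> R -> 'M[R]_d) : Prop :=
  forall tau, 0 <= tau ->
    Phi tau tau = 1%:M /\
    forall t, 0 <= t ->
      has_tderiv (fun s => Phi s tau) t (A t *m Phi t tau).

Definition mximg {R : realType} {d : nat} (M : 'M[R]_d) (V : {vspace 'cV[R]_d}) :
    {vspace 'cV[R]_d} :=
  (linfun (mulmx M : 'cV[R]_d -> 'cV[R]_d) @: V)%VS.

Definition alpha_cont {R : realType} {d : nat} (A : R -> 'M[R]_d)
    (Phi : R -> R -> 'M[R]_d) (T : R) (V0 : {vspace 'cV[R]_d}) : R :=
  T^-1 * \int[lebesgue_measure]_(t in `[0, T])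
    (let P := orth_proj (mximg (Phi t 0) V0) in
     spectral_norm ((1%:M - P) *m A t *m P)).

(* The horizon is T = N h; the value depends on V0 only through x. *)
Definition alpha_diff {R : realType} {d : nat} (x : R -> 'cV[R]_d) (h : R)
    (N : nat) : R :=
  (N%:R * h)^-1 * \sum_(1 <= j < N.+1)
    angle (x (j.-1%:R * h) - x (j%:R * h)) (x (j%:R * h) - x (j.+1%:R * h)).

Definition range_cont {R : realType} {d : nat} (A : R -> 'M[R]_d)
    (Phi : R -> R -> 'M[R]_d) (V0 : {vspace 'cV[R]_d}) : set R :=
  let a := fun T : R => (alpha_cont A Phi T V0)%:E in
  [set y : R | (limf_einf a +oo%R <= y%:E)%E /\ (y%:E <= limf_esup a +oo%R)%E].

Definition range_diff {R : realType} {d : nat} (x : R -> 'cV[R]_d) (h : R) :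
    set R :=
  let a := fun N : nat => (alpha_diff x h N)%:E in
  [set y : R | (limn_einf a <= y%:E)%E /\ (y%:E <= limn_esup a)%E].

Definition hausdorff_dist {R : realType} (X Y : set R) : \bar R :=
  maxe (ereal_sup [set edist_inf Y a | a in X])
       (ereal_sup [set edist_inf X b | b in Y]).

(* Main.v *)
Require Import Defs.
From mathcomp Require Import all_boot all_order all_algebra.
From mathcomp Require Import all_classical all_reals all_analysis.
From mathcomp Require Import ring lra.
Import Order.TTheory GRing.Theory Num.Theory.
Import numFieldNormedType.Exports.

(** The velocity [v t = f (x t)] solves the variational equation [v' = A v] and
    spans the initial subspace, so [Phi t 0] carries [V0] to the line of [v t].
    For a line, the integrand of [alpha_cont] is the rank-one quantity
    [turning_speed t = line_dist (a t) (v t) / |v t|] with [a = A v], the speed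
    at which the direction of [v] turns ([spectral_norm_line],
    [alpha_cont_time_average]).

    On the other side, consecutive difference quotients of [x] with step [h] are
    [v t - (h / 2) a t] and [v t + (h / 2) a t] up to [O(h ^ 2 |v t|)], so the
    angle between them is [h * turning_speed t + O(h ^ 2)] ([angle_step]). The
    angles thus form a Riemann sum of the turning speed. Since the latter is
    Lipschitz ([turning_speed_lip]), the averages over the same horizon [N h]
    differ by [O(h)], uniformly in [N] ([averages_at_grid]), and the continuous
    average varies by [O(h)] only between two consecutive horizons
    ([averages_between]). Hence the lower and upper limits agree up to [O(h)],
    and so do the intervals that they bound ([hausdorff_dist_limit_ranges]).

    The point is that no constant may depend on the time. A bounded trajectory
    gives uniform bounds for [A] and for its Lipschitz constant by compactness,
    but its speed [|v t|] may tend to zero. Everything is therefore estimated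
    relative to [|v t|]: the Gronwall inequality ([eucl_gronwall]) makes the
    speeds at times within distance one comparable, and it also shows that the
    speed never vanishes on a nonconstant trajectory ([velocity_neq0]). *)

Set Implicit Arguments.
Unset Strict Implicit.
Unset Printing Implicit Defensive.

Local Open Scope classical_set_scope.
Local Open Scope ring_scope.

(** * Distance to a line in Euclidean space *)

Section Euclid.
Context {R : realType} {d : nat}.
Implicit Types u v w p q a : 'cV[R]_d.

Definition dot u v : R := \sum_(i < d) u i ord0 * v i ord0.

Lemma mulmx_dot u v : (u^T *m v) ord0 ord0 = dot u v.
Proof. by rewrite mxE; apply: eq_bigr => i _; rewrite mxE. Qed.

Lemma dotC u v : dot u v = dot v u.
Proof. by apply: eq_bigr => i _; rewrite mulrC. Qed.

Lemma dotDl u v w : dot (u + v) w = dot u w + dot v w.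
Proof. by rewrite -big_split; apply: eq_bigr => i _ /=; rewrite mxE mulrDl. Qed.

Lemma dotZl k u v : dot (k *: u) v = k * dot u v.
Proof. by rewrite mulr_sumr; apply: eq_bigr => i _; rewrite mxE mulrA. Qed.

Lemma dotNl u v : dot (- u) v = - dot u v.
Proof. by rewrite -scaleN1r dotZl mulN1r. Qed.

Lemma dotBl u v w : dot (u - v) w = dot u w - dot v w.
Proof. by rewrite dotDl dotNl. Qed.

Lemma dotDr u v w : dot w (u + v) = dot w u + dot w v.
Proof. by rewrite dotC dotDl !(dotC w). Qed.

Lemma dotZr k u v : dot v (k *: u) = k * dot v u.
Proof. by rewrite dotC dotZl dotC. Qed.

Lemma dotNr u v : dot v (- u) = - dot v u.
Proof. by rewrite dotC dotNl dotC. Qed.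

Lemma dotBr u v w : dot w (u - v) = dot w u - dot w v.
Proof. by rewrite dotDr dotNr. Qed.

Lemma dot0r v : dot v 0 = 0.
Proof. by rewrite -(scale0r (0 : 'cV[R]_d)) dotZr mul0r. Qed.

Definition dotE := (dotDl, dotDr, dotNl, dotNr, dotZl, dotZr).

Lemma dot_ge0 v : 0 <= dot v v.
Proof. by apply: sumr_ge0 => i _; rewrite -expr2 sqr_ge0. Qed.

Lemma dot_eq0 v : (dot v v == 0) = (v == 0).
Proof.
apply/idP/eqP => [|->]; last by rewrite /dot big1// => i _; rewrite mxE mul0r.
rewrite psumr_eq0 => [/allP v0|i _]; last by rewrite -expr2 sqr_ge0.
apply/matrixP => i j; rewrite ord1 mxE.
by have := v0 i (mem_index_enum _); rewrite -expr2 sqrf_eq0 => /eqP.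
Qed.

Lemma eucl_normE v : eucl_norm v = Num.sqrt (dot v v).
Proof. by congr Num.sqrt; apply: eq_bigr => i _; rewrite expr2. Qed.

Lemma eucl_norm_sqr v : eucl_norm v ^+ 2 = dot v v.
Proof. by rewrite eucl_normE sqr_sqrtr ?dot_ge0. Qed.

Lemma eucl_norm_ge0 v : 0 <= eucl_norm v.
Proof. exact: sqrtr_ge0. Qed.

Lemma eucl_norm_eq0 v : (eucl_norm v == 0) = (v == 0).
Proof. by rewrite -sqrf_eq0 eucl_norm_sqr dot_eq0. Qed.

Lemma eucl_norm_gt0 v : (0 < eucl_norm v) = (v != 0).
Proof. by rewrite lt_def eucl_norm_ge0 andbT eucl_norm_eq0. Qed.

Lemma dot_gt0 v : (0 < dot v v) = (v != 0).
Proof. by rewrite lt_def dot_ge0 andbT dot_eq0. Qed.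

Lemma eucl_normZ k v : eucl_norm (k *: v) = `|k| * eucl_norm v.
Proof.
by rewrite !eucl_normE dotZl dotZr mulrA -expr2 sqrtrM ?sqr_ge0// sqrtr_sqr.
Qed.

Lemma eucl_normN v : eucl_norm (- v) = eucl_norm v.
Proof. by rewrite -scaleN1r eucl_normZ normrN1 mul1r. Qed.

Lemma eucl_norm0 : eucl_norm (0 : 'cV[R]_d) = 0.
Proof. by apply/eqP; rewrite eucl_norm_eq0. Qed.

Lemma eucl_norm_distC u v : eucl_norm (u - v) = eucl_norm (v - u).
Proof. by rewrite -eucl_normN opprB. Qed.

Definition perp_part a p : 'cV[R]_d := a - (dot a p / dot p p) *: p.

Definition line_dist a p : R := eucl_norm (perp_part a p).

Lemma dot_perp_part a p : dot (perp_part a p) p = 0.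
Proof.
rewrite /perp_part dotBl dotZl; have [->|p0] := eqVneq p 0.
  by rewrite !dot0r mulr0 subr0.
by rewrite divfK ?subrr// dot_eq0.
Qed.

Lemma line_dist_sqr a p :
  line_dist a p ^+ 2 = dot a a - dot a p ^+ 2 / dot p p.
Proof.
rewrite /line_dist eucl_norm_sqr {2}/perp_part dotBr dotZr dot_perp_part.
rewrite mulr0 subr0.
by rewrite /perp_part dotBl dotZl dotC (dotC p) expr2 mulrAC.
Qed.

(** The defect in this inequality is a squared distance to a line. *)
Lemma cauchy_schwarz u v : `|dot u v| <= eucl_norm u * eucl_norm v.
Proof.
rewrite -(ler_pXn2r (n := 2))// ?nnegrE ?mulr_ge0 ?eucl_norm_ge0//.
rewrite real_normK ?num_real// exprMn !eucl_norm_sqr.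
have [->|v0] := eqVneq v 0.
  by rewrite !dot0r expr2 mulr0 mulr0.
have := sqr_ge0 (line_dist u v).
by rewrite line_dist_sqr subr_ge0 ler_pdivrMr ?dot_gt0.
Qed.

Lemma ler_eucl_normD u v : eucl_norm (u + v) <= eucl_norm u + eucl_norm v.
Proof.
rewrite -(ler_pXn2r (n := 2))// ?nnegrE ?addr_ge0 ?eucl_norm_ge0//.
rewrite sqrrD !eucl_norm_sqr !dotE (dotC v u).
have := le_trans (ler_norm _) (cauchy_schwarz u v); lra.
Qed.

Lemma ler_eucl_dist u v : `|eucl_norm u - eucl_norm v| <= eucl_norm (u - v).
Proof.
have := ler_eucl_normD (u - v) v; have := ler_eucl_normD (v - u) u.
rewrite !subrK (eucl_norm_distC v) ler_norml; lra.
Qed.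

Lemma ler_coord_eucl_norm v i : `|v i ord0| <= eucl_norm v.
Proof.
rewrite eucl_normE -sqrtr_sqr ler_sqrt ?dot_ge0//.
rewrite /dot (bigD1 i)//= -expr2 lerDl.
by apply: sumr_ge0 => j _; rewrite -expr2 sqr_ge0.
Qed.

Lemma ler_eucl_norm_sum v : eucl_norm v <= \sum_(i < d) `|v i ord0|.
Proof.
have s0 : 0 <= \sum_(i < d) `|v i ord0| by apply: sumr_ge0.
rewrite -(ler_pXn2r (n := 2))// ?nnegrE ?eucl_norm_ge0//.
rewrite eucl_norm_sqr expr2 {1}mulr_suml; apply: ler_sum => i _.
apply: le_trans (ler_norm _) _; rewrite normrM ler_wpM2l//.
by rewrite (bigD1 i)//= lerDl sumr_ge0.
Qed.

(** By Pythagoras. All the perturbation estimates below test this inequality on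
    a multiple [c] that is optimal for a nearby pair of vectors, and so never
    differentiate a projection. *)
Lemma line_dist_min a p c : line_dist a p <= eucl_norm (a - c *: p).
Proof.
rewrite -(ler_pXn2r (n := 2))// ?nnegrE ?eucl_norm_ge0// [leRHS]eucl_norm_sqr.
have -> : a - c *: p = perp_part a p + (dot a p / dot p p - c) *: p.
  by rewrite /perp_part scalerBl addrA subrK.
rewrite /line_dist eucl_norm_sqr.
move: (perp_part a p) (dot_perp_part a p) => r rp.
rewrite !dotE (dotC p r) rp !mulr0 addr0 add0r lerDl mulrA.
by rewrite -expr2 mulr_ge0 ?sqr_ge0 ?dot_ge0.
Qed.

Lemma line_dist_ge0 a p : 0 <= line_dist a p.
Proof. exact: eucl_norm_ge0. Qed.

Lemma line_dist_le_norm a p : line_dist a p <= eucl_norm a.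
Proof. by have := line_dist_min a p 0; rewrite scale0r subr0. Qed.

Lemma line_dist_le_subl a b p :
  line_dist a p <= line_dist b p + eucl_norm (a - b).
Proof.
rewrite addrC; apply: le_trans (line_dist_min _ _ (dot b p / dot p p)) _.
by rewrite /line_dist -[a in leLHS](subrK b) -addrA ler_eucl_normD.
Qed.

Lemma line_dist_lipl a b p :
  `|line_dist a p - line_dist b p| <= eucl_norm (a - b).
Proof.
have := line_dist_le_subl a b p; have := line_dist_le_subl b a p.
rewrite (eucl_norm_distC b) ler_norml; lra.
Qed.

Lemma line_dist_le_subr a p q : q != 0 ->
  line_dist a p <=
    line_dist a q + eucl_norm a / eucl_norm q * eucl_norm (p - q).
Proof.
move=> q0; apply: le_trans (line_dist_min _ _ (dot a q / dot q q)) _.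
have -> : a - (dot a q / dot q q) *: p =
    perp_part a q + (dot a q / dot q q) *: (q - p).
  by rewrite /perp_part scalerBr addrA subrK.
apply: le_trans (ler_eucl_normD _ _) _; rewrite lerD2l eucl_normZ.
rewrite (eucl_norm_distC q) ler_wpM2r ?eucl_norm_ge0// normrM normfV.
rewrite (ger0_norm (dot_ge0 _)) -eucl_norm_sqr ler_pdivrMr; last first.
  by rewrite exprn_gt0// eucl_norm_gt0.
rewrite expr2 mulrA divfK ?eucl_norm_eq0//; exact: cauchy_schwarz.
Qed.

Lemma line_distZ k a p : line_dist (k *: a) p = `|k| * line_dist a p.
Proof.
rewrite /line_dist /perp_part dotZl -eucl_normZ; congr eucl_norm.
by rewrite scalerBr scalerA mulrA.
Qed.

Lemma line_distDl a p : line_dist (a + p) p = line_dist a p.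
Proof.
have [->|p0] := eqVneq p 0; first by rewrite addr0.
rewrite /line_dist /perp_part dotDl mulrDl divff ?dot_eq0// scalerDl scale1r.
by rewrite opprD addrACA subrr addr0.
Qed.

Lemma angle_scale k l v w : k != 0 -> l != 0 ->
  angle (k *: v) (l *: w) = angle v w.
Proof.
move=> k0 l0; rewrite /angle; congr acos; rewrite !mulmx_dot dotZl dotZr.
rewrite !eucl_normZ !normrM mulrCA mulrA [X in _ / X]mulrACA.
by rewrite -mulf_div (mulrC `|l|) divff ?mul1r// mulf_neq0 ?normr_eq0.
Qed.

End Euclid.

(** * Angles and their sines *)

(** Put [t = acos c], so that the square root is [sin t]. The mean value theorem
    gives [sin t = t cos z] with [c <= cos z <= 1], hence
    [0 <= t - sin t <= t (1 - c)]; conclude by [t <= pi / 2 < 2] and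
    [1 - c <= 1 - c ^+ 2]. *)
Lemma acos_sin_bounds {R : realType} (c : R) : 0 <= c <= 1 ->
  Num.sqrt (1 - c ^+ 2) <= acos c <=
    Num.sqrt (1 - c ^+ 2) + 2 * Num.sqrt (1 - c ^+ 2) ^+ 2.
Proof.
move=> /andP[c0 c1]; set S := Num.sqrt _.
have c11 : -1 <= c <= 1 by apply/andP; split=> //; lra.
have S0 : 0 <= S by exact: sqrtr_ge0.
have S2 : S ^+ 2 = 1 - c ^+ 2 by rewrite sqr_sqrtr// subr_ge0 expr_le1.
have sinE : sin (acos c) = S := sin_acos c11; have cosE := acosK c11.
set t := acos c in sinE cosE *.
have t0 : 0 <= t by exact: acos_ge0.
have t2 : t <= 2.
  rewrite /t; apply: le_trans (ltW (pihalf_lt2 R)); rewrite leNgt.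
  apply/negP => h.
  have : cos t < cos (pi / 2).
    rewrite ltr_cos// in_itv/= ?t0 ?acos_lepi// divr_ge0 ?pi_ge0//=.
    by rewrite ler_pdivrMr//; have := pi_gt0 R; lra.
  by rewrite cos_pihalf cosE; lra.
move: t0; rewrite le_eqVlt => /orP[/eqP t0|t0].
  by rewrite -sinE -t0 sin0 expr2 !mulr0 addr0 lexx.
have [z zt] : exists2 z, z \in `]0, t[ & sin t - sin 0 = cos z * (t - 0).
  apply: MVT => //; apply: continuous_subspaceT; exact: continuous_sin.
rewrite sin0 !subr0 sinE -/S => Sz; have /andP[z0 zt'] := zt.
have cz1 := cos_le1 z.
have ccz : c <= cos z.
  rewrite -cosE ltW// ltr_cos// in_itv/= ltW//=.
    by rewrite (le_trans (ltW zt'))// acos_lepi.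
  by rewrite acos_lepi// andbT.
rewrite Sz ler_piMl//=; last exact: ltW.
have cc : 1 - c <= S ^+ 2 by rewrite S2; nra.
rewrite -Sz.
have : t - cos z * t <= 2 * S ^+ 2 by nra.
by rewrite -Sz; lra.
Qed.

(** The quotient is the sine of the angle, which is small for the vectors of
    interest; the angle differs from it by second order only. *)
Lemma angle_sin_bounds {R : realType} {d : nat} (p q : 'cV[R]_d) :
  p != 0 -> q != 0 ->
  line_dist q p / eucl_norm q <= angle p q <=
    line_dist q p / eucl_norm q + 2 * (line_dist q p / eucl_norm q) ^+ 2.
Proof.
move=> p0 q0; set S := line_dist q p / eucl_norm q.
rewrite /angle mulmx_dot.
have pq0 : 0 < eucl_norm p * eucl_norm q by rewrite mulr_gt0 ?eucl_norm_gt0.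
set c := _ / _.
have -> : S = Num.sqrt (1 - c ^+ 2).
  apply/eqP; rewrite -(eqrXn2 (n := 2))// ?sqrtr_ge0//; last first.
    by rewrite /S divr_ge0 ?line_dist_ge0 ?eucl_norm_ge0.
  have E : 1 - c ^+ 2 = S ^+ 2.
    rewrite /S /c !expr_div_n line_dist_sqr exprMn !eucl_norm_sqr (dotC q p).
    rewrite real_normK ?num_real//; field; by rewrite !dot_eq0 p0 q0.
  by rewrite sqr_sqrtr E ?sqr_ge0.
apply: acos_sin_bounds; apply/andP; split.
  by rewrite divr_ge0// ltW.
by rewrite /c ler_pdivrMr// mul1r cauchy_schwarz.
Qed.

(** * Calculus on the half line *)

Section Calculus.
Context {R : realType}.
Implicit Types (phi psi : R -> R).

(** Right-continuity is all that is asked at the endpoint [0]: it is what the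
    mean value theorem on [[0, b]] needs, and it survives sums and products. *)
Definition half_deriv phi phi' : Prop :=
  phi @ 0^'+ --> phi 0 /\ forall t : R, 0 < t -> is_derive t 1 phi (phi' t).

Lemma half_deriv_ext phi phi' psi' : (forall t : R, 0 < t -> phi' t = psi' t) ->
  half_deriv phi phi' -> half_deriv phi psi'.
Proof. by move=> e [p0 dp]; split=> // t t0; rewrite -e//; exact: dp. Qed.

Lemma half_derivD phi phi' psi psi' : half_deriv phi phi' ->
  half_deriv psi psi' -> half_deriv (phi \+ psi) (phi' \+ psi').
Proof.
move=> [p0 dp] [q0 dq]; split; first exact: cvgD.
by move=> t t0; apply: is_deriveD; [exact: dp|exact: dq].
Qed.

Lemma half_derivM phi phi' psi psi' : half_deriv phi phi' ->
  half_deriv psi psi' ->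
  half_deriv (phi \* psi) (fun t => phi t * psi' t + phi' t * psi t).
Proof.
move=> [p0 dp] [q0 dq]; split; first exact: cvgM.
move=> t t0; apply: (is_derive_eq (is_deriveM (dp _ t0) (dq _ t0))).
by rewrite /GRing.scale/= (mulrC (phi' t)).
Qed.

Lemma half_deriv_cst (c : R) : half_deriv (fun=> c) (fun=> 0).
Proof. by split; [exact: cvg_cst|move=> t _; exact: is_derive_cst]. Qed.

Lemma half_deriv_id : half_deriv id (fun=> 1).
Proof.
split; last by move=> t _; exact: is_derive_id.
by apply: cvg_at_right_filter; exact: cvg_id.
Qed.

Lemma half_derivZ (c : R) phi phi' : half_deriv phi phi' ->
  half_deriv (fun t => c * phi t) (fun t => c * phi' t).
Proof.
move=> dp; have := half_derivM (half_deriv_cst c) dp.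
by apply: half_deriv_ext => t _; rewrite mul0r addr0.
Qed.

Lemma half_derivB phi phi' psi psi' : half_deriv phi phi' ->
  half_deriv psi psi' -> half_deriv (phi \- psi) (phi' \- psi').
Proof.
move=> dp /(half_derivZ (-1)) dq; have := half_derivD dp dq.
rewrite (_ : _ \+ _ = phi \- psi); last by apply/funext => t /=; rewrite mulN1r.
by apply: half_deriv_ext => t _ /=; rewrite mulN1r.
Qed.

Lemma half_deriv_sum n (phi phi' : 'I_n -> R -> R) :
  (forall i, half_deriv (phi i) (phi' i)) ->
  half_deriv (fun t => \sum_(i < n) phi i t) (fun t => \sum_(i < n) phi' i t).
Proof.
elim: n phi phi' => [|n IH] phi phi' dp.
  rewrite (_ : (fun t => _) = fun=> 0); last first.
    by apply/funext => t; rewrite big_ord0.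
  by apply: half_deriv_ext (half_deriv_cst 0) => t _; rewrite big_ord0.
have := half_derivD (dp ord0) (IH _ _ (fun i => dp (lift ord0 i))).
rewrite (_ : _ \+ _ = fun t => \sum_(i < n.+1) phi i t); last first.
  by apply/funext => t; rewrite big_ord_recl.
by apply: half_deriv_ext => t _; rewrite big_ord_recl.
Qed.

Lemma half_deriv_within phi phi' a b : half_deriv phi phi' -> 0 <= a -> a < b ->
  {within `[a, b], continuous phi}.
Proof.
move=> [p0 dp] a0 ab.
have cp t : 0 < t -> {for t, continuous phi}.
  move=> t0; apply/differentiable_continuous/derivable1_diffP.
  exact: (@ex_derive _ _ _ _ _ _ _ (dp t t0)).
apply/continuous_within_itvP => //; split.
- by move=> t; rewrite in_itv/= => /andP[/(le_lt_trans a0) + _]; exact: cp.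
- move: a0; rewrite le_eqVlt => /predU1P[<-//|a0].
  by apply: cvg_at_right_filter; exact: cp.
- by apply: cvg_at_left_filter; apply: cp; exact: le_lt_trans ab.
Qed.

Lemma half_deriv_MVT phi phi' a b : half_deriv phi phi' -> 0 <= a -> a < b ->
  exists2 c, a < c < b & phi b - phi a = phi' c * (b - a).
Proof.
move=> dp a0 ab; have [||c] := @MVT R phi phi' a b ab.
- by move=> t; rewrite in_itv/= => /andP[/(le_lt_trans a0) + _]; exact: dp.2.
- exact: half_deriv_within dp a0 ab.
by rewrite in_itv/= => cab E; exists c.
Qed.

Lemma half_deriv_incr phi phi' a b : half_deriv phi phi' ->
  (forall t : R, 0 < t -> 0 <= phi' t) -> 0 <= a -> a <= b -> phi a <= phi b.
Proof.
move=> dp p0 a0; rewrite le_eqVlt => /predU1P[->//|ab].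
have [c /andP[ac cb] E] := half_deriv_MVT dp a0 ab.
by rewrite -subr_ge0 E mulr_ge0 ?p0 ?subr_ge0 ?ltW//; exact: le_lt_trans ac.
Qed.

Lemma half_deriv_bound phi phi' a b (K : R) : half_deriv phi phi' ->
  0 <= a -> a <= b -> (forall c, a <= c <= b -> `|phi' c| <= K) ->
  `|phi b - phi a| <= K * (b - a).
Proof.
move=> dp a0; rewrite le_eqVlt => /predU1P[<- _|ab pK].
  by rewrite !subrr normr0 mulr0.
have [c /andP[ac cb] ->] := half_deriv_MVT dp a0 ab.
by rewrite normrM (gtr0_norm (_ : 0 < b - a)) ?subr_gt0// ler_wpM2r
   ?pK ?subr_ge0 ?ltW.
Qed.

Lemma half_deriv_expR (K : R) :
  half_deriv (fun t : R => expR (K * t)) (fun t => K * expR (K * t)).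
Proof.
have dK (t : R) : is_derive t 1 (fun t : R => expR (K * t)) (K * expR (K * t)).
  have dK : is_derive t 1 (fun t : R => K * t : R) K.
    apply: (is_derive_eq (@is_deriveZ R R R id K t 1 1 (is_derive_id _ _))).
    by rewrite /GRing.scale/= mulr1.
  apply: (is_derive_eq (is_derive1_comp (is_derive_expR _) dK)).
  by rewrite mulrC.
split; last by move=> t _; exact: dK.
have cK : {for (0 : R), continuous (fun t : R => expR (K * t))}.
  apply/differentiable_continuous/derivable1_diffP.
  exact: (@ex_derive _ _ _ _ _ _ _ (dK 0)).
exact: cvg_at_right_filter cK.
Qed.

(** [phi t * expR (K * t)] is nondecreasing and [phi t * expR (- K * t)] is
    nonincreasing; the first settles [s <= t], the second [t <= s]. *)
Lemma gronwall phi phi' (K : R) : half_deriv phi phi' ->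
  (forall t : R, 0 < t -> `|phi' t| <= K * phi t) ->
  forall s t, 0 <= s -> 0 <= t -> phi s <= expR (K * `|s - t|) * phi t.
Proof.
move=> dp pK s t s0 t0.
have e0 (u : R) : expR u > 0 := expR_gt0 u.
have [st|ts] := leP s t.
  have := half_deriv_incr (half_derivM (half_deriv_expR K) dp) _ s0 st.
  case/(_ _)/wrap => [u u0|].
    have -> : expR (K * u) * phi' u + K * expR (K * u) * phi u =
        expR (K * u) * (phi' u + K * phi u) by ring.
    apply: mulr_ge0; first exact: ltW.
    have := pK u u0; rewrite ler_norml => /andP[]; lra.
  rewrite /= => /(ler_wpM2l (ltW (e0 (- (K * s))))).
  rewrite !mulrA -!expRD addNr expR0 mul1r distrC ger0_norm ?subr_ge0//.
  by rewrite mulrBr addrC.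
have dexp := half_derivM (half_deriv_expR (- K)) dp.
have := half_deriv_incr (half_derivB (half_deriv_cst 0) dexp) _ t0 (ltW ts).
case/(_ _)/wrap => [u u0|].
  rewrite /= sub0r oppr_ge0.
  have -> : expR (- K * u) * phi' u + - K * expR (- K * u) * phi u =
      expR (- K * u) * (phi' u - K * phi u) by ring.
  have := pK u u0; rewrite ler_norml => /andP[_ h].
  by rewrite pmulr_rle0//; lra.
rewrite /= !sub0r lerN2 => /(ler_wpM2l (ltW (e0 (K * s)))).
rewrite !mulrA -!expRD mulNr subrr expR0 mul1r gtr0_norm ?subr_gt0//.
by rewrite mulrBr mulNr.
Qed.

End Calculus.

(** * Vector-valued functions on the half line *)

Section VectorCalculus.
Context {R : realType}.

(** Away from [0] the constraint that times are nonnegative is void in the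
    limit. *)
Lemma has_tderiv_is_derive {V : normedModType R} (u : R -> V) (t : R) (l : V) :
  0 < t -> has_tderiv u t l -> is_derive t 1 u l.
Proof.
move=> t0 ul.
have sh : (fun h : R => h + t) @ 0^' --> punctured_nneg t.
  move=> P; rewrite /punctured_nneg /within/= => -[e /= e0 eP].
  exists (Num.min e t) => [|h /=]; first by rewrite /= lt_min e0.
  rewrite sub0r normrN lt_min => /andP[he ht] h0; apply: eP => /=.
  - by rewrite opprD addrCA subrr addr0 normrN.
  - by rewrite -subr_eq0 addrK.
  - by move: ht; rewrite ltr_norml => /andP[]; lra.
have {}ul : (h^-1 *: ((u \o shift t) (h *: (1 : R)) - u t)) @[h --> 0^'] --> l.
  have := cvg_comp _ _ sh ul; rewrite /diff_quot.
  rewrite (_ : _ \o _ =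
    fun h : R => h^-1 *: ((u \o shift t) (h *: (1 : R)) - u t)) //.
  by apply/funext => h /=; rewrite addrK /GRing.scale/= mulr1.
by apply: DeriveDef; [apply/cvg_ex; exists l | exact: cvg_lim].
Qed.

Lemma has_tderiv_cvg0 {V : normedModType R} (u : R -> V) (l : V) :
  has_tderiv u 0 l -> u @ 0^'+ --> u 0.
Proof.
move=> ul.
have ul' : diff_quot u 0 @ 0^'+ --> l.
  move=> P /ul [e e0 eP]; exists e => // s se s0.
  by apply: (eP s se); [rewrite gt_eqF|exact: ltW].
have id0 : (id : R -> R) @ 0^'+ --> (0 : R).
  by apply: cvg_at_right_filter; exact: cvg_id.
have E : {near (0 : R)^'+, (fun s => u 0 + s *: diff_quot u 0 s) =1 u}.
  near=> s; have s0 : 0 < s by near: s; exact: nbhs_right_gt.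
  by rewrite /diff_quot subr0 scalerA divff ?gt_eqF// scale1r addrC subrK.
apply: (cvg_trans (near_eq_cvg E)).
rewrite -[u 0 in X in _ `=>` X]addr0 -(scale0r l).
exact: cvgD (cvg_cst (u 0)) (cvgZ id0 ul').
Unshelve. all: by end_near. Qed.

Definition entry_deriv {m n} (u u' : R -> 'M[R]_(m, n)) : Prop :=
  forall i j, half_deriv (fun t => u t i j) (fun t => u' t i j).

Lemma is_derive_coord {m n} (u : R -> 'M[R]_(m, n)) (t : R) l i j :
  is_derive t 1 u l -> is_derive t 1 (fun t => u t i j) (l i j).
Proof.
move=> ul; have du : derivable u t 1 by exact: ex_derive.
have := derive_mx du; rewrite derive_val => ->; rewrite mxE.
apply: derivableP; exact: (derivable_mxP u t 1).1 du i j.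
Qed.

Lemma has_tderiv_entry {m n} (u u' : R -> 'M[R]_(m, n)) :
  (forall t, 0 <= t -> has_tderiv u t (u' t)) -> entry_deriv u u'.
Proof.
move=> uu' i j; split.
  have /has_tderiv_cvg0 c := uu' 0 (lexx 0).
  exact: cvg_comp c (@coord_continuous R m n i j _).
move=> t t0; apply: is_derive_coord; apply: has_tderiv_is_derive => //.
by apply: uu'; exact: ltW.
Qed.

Lemma entry_derivB {m n} (u u' w w' : R -> 'M[R]_(m, n)) :
  entry_deriv u u' -> entry_deriv w w' ->
  entry_deriv (fun t => u t - w t) (fun t => u' t - w' t).
Proof.
move=> du dw i j; have := half_derivB (du i j) (dw i j).
rewrite (_ : _ \- _ = fun t => (u t - w t) i j); last first.
  by apply/funext => t; rewrite !mxE.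
by apply: half_deriv_ext => t _; rewrite !mxE.
Qed.

Lemma entry_deriv_mulmxl {m n p} (M M' : R -> 'M[R]_(m, n)) (B : 'M[R]_(n, p)) :
  entry_deriv M M' -> entry_deriv (fun t => M t *m B) (fun t => M' t *m B).
Proof.
move=> dM i j.
have := half_deriv_sum (fun k => half_derivZ (B k j) (dM i k)).
rewrite (_ : (fun t : R => _) = fun t => (M t *m B) i j); last first.
  by apply/funext => t; rewrite !mxE; apply: eq_bigr => k _; rewrite mulrC.
apply: half_deriv_ext => t _; rewrite !mxE.
by apply: eq_bigr => k _; rewrite mulrC.
Qed.

Lemma entry_deriv_scale {m n} (k k' : R -> R) (B : 'M[R]_(m, n)) :
  half_deriv k k' -> entry_deriv (fun t => k t *: B) (fun t => k' t *: B).
Proof.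
move=> dk i j; have := half_derivZ (B i j) dk.
rewrite (_ : (fun t : R => _) = fun t => (k t *: B) i j); last first.
  by apply/funext => t; rewrite !mxE mulrC.
by apply: half_deriv_ext => t _; rewrite !mxE mulrC.
Qed.

Lemma half_deriv_dot {d} (u u' : R -> 'cV[R]_d) (w w' : R -> 'cV[R]_d) :
  entry_deriv u u' -> entry_deriv w w' ->
  half_deriv (fun t => dot (u t) (w t))
    (fun t => dot (u t) (w' t) + dot (u' t) (w t)).
Proof.
move=> du dw.
have := half_deriv_sum (fun i => half_derivM (du i ord0) (dw i ord0)).
by apply: half_deriv_ext => t _; rewrite /dot -big_split.
Qed.

(** The mean value inequality: apply the scalar mean value theorem in the
    direction [u b - u a]. *)
Lemma entry_deriv_bound {d} (u u' : R -> 'cV[R]_d) (K a b : R) :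
  entry_deriv u u' -> 0 <= a -> a <= b ->
  (forall c, a <= c <= b -> eucl_norm (u' c) <= K) ->
  eucl_norm (u b - u a) <= K * (b - a).
Proof.
move=> du a0 ab uK; set e := u b - u a.
have [->|e0] := eqVneq e 0.
  rewrite eucl_norm0 mulr_ge0 ?subr_ge0// (le_trans _ (uK a _))//.
    exact: eucl_norm_ge0.
  by rewrite lexx.
have de : entry_deriv (fun=> e) (fun=> 0).
  by move=> i j; apply: half_deriv_ext (half_deriv_cst _) => t _; rewrite mxE.
have uK' c : a <= c <= b -> `|dot (u c) 0 + dot (u' c) e| <= K * eucl_norm e.
  move=> /uK {}uK; rewrite dot0r add0r (le_trans (cauchy_schwarz _ _))//.
  by rewrite ler_wpM2r// eucl_norm_ge0.
have := half_deriv_bound (half_deriv_dot du de) a0 ab uK'.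
rewrite -dotBl -/e -eucl_norm_sqr normrX ger0_norm ?eucl_norm_ge0//.
by rewrite expr2 mulrAC ler_pM2r// eucl_norm_gt0.
Qed.

Lemma entry_deriv_lip {d} (u u' : R -> 'cV[R]_d) (K s t : R) :
  entry_deriv u u' -> 0 <= s -> 0 <= t ->
  (forall r, 0 <= r -> `|r - t| <= `|s - t| -> eucl_norm (u' r) <= K) ->
  eucl_norm (u s - u t) <= K * `|s - t|.
Proof.
move=> du s0 t0 uK; have [st|ts] := leP s t.
  rewrite eucl_norm_distC distrC (ger0_norm (_ : 0 <= t - s)) ?subr_ge0//.
  apply: entry_deriv_bound => // c /andP[sc ct]; apply: uK.
    exact: le_trans sc.
  by rewrite !ler0_norm ?subr_le0//; lra.
rewrite (gtr0_norm (_ : 0 < s - t)) ?subr_gt0//.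
apply: (entry_deriv_bound du) => //; first exact: ltW.
move=> c /andP[tc cs]; apply: uK; first exact: le_trans tc.
have ts' := ltW ts; by rewrite !ger0_norm ?subr_ge0//; lra.
Qed.

(** The scalar estimate applied to [|u| ^+ 2], whose derivative is at most
    [2 * L * |u| ^+ 2] in absolute value. It yields uniqueness for linear
    equations, both forward and backward in time, and the comparability of the
    speeds at nearby times. *)
Lemma eucl_gronwall {d} (u u' : R -> 'cV[R]_d) (L : R) :
  entry_deriv u u' ->
  (forall t, 0 <= t -> eucl_norm (u' t) <= L * eucl_norm (u t)) ->
  forall s t, 0 <= s -> 0 <= t ->
  eucl_norm (u s) <= expR (L * `|s - t|) * eucl_norm (u t).
Proof.
move=> du uL s t s0 t0.
have uL' r : 0 < r ->
    `|dot (u r) (u' r) + dot (u' r) (u r)| <= (L * 2) * dot (u r) (u r).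
  move=> r0; rewrite (dotC (u' r)) -mulr2n -(mulr_natl (dot _ _)) normrM.
  rewrite ger0_norm//.
  rewrite (mulrC L) -mulrA ler_wpM2l// (le_trans (cauchy_schwarz _ _))//.
  by rewrite -eucl_norm_sqr expr2 mulrCA ler_wpM2l ?eucl_norm_ge0// uL// ltW.
have := gronwall (half_deriv_dot du du) uL' s0 t0.
rewrite -!eucl_norm_sqr mulrAC expRM_natr -exprMn ler_pXn2r// nnegrE.
  exact: eucl_norm_ge0.
by rewrite mulr_ge0 ?expR_ge0 ?eucl_norm_ge0.
Qed.

End VectorCalculus.

(** * Compression of an operator to a line *)

Section LineProjector.
Context {R : realType} {d : nat}.
Implicit Types w y : 'cV[R]_d.

Lemma mximg_line (M : 'M[R]_d) w : mximg M <[w]>%VS = <[M *m w]>%VS.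
Proof. by rewrite /mximg limg_line lfunE. Qed.

(** A one-column basis matrix is stated with an arbitrary column count [n = 1]
    because the dimension of a line is only propositionally [1]. *)
Lemma proj_mx_column n (B : 'M[R]_(d, n)) w (k : R) : n = 1%N -> k != 0 ->
  w != 0 -> (forall i j, B i j = k * w i ord0) ->
  B *m invmx (B^T *m B) *m B^T = (dot w w)^-1 *: (w *m w^T).
Proof.
move=> n1; subst n => k0 w0 Bw.
have -> : B = k *: w by apply/matrixP => i j; rewrite Bw mxE (ord1 j).
rewrite !linearZ/= -!scalemxAl.
have -> : w^T *m w = (dot w w)%:M.
  by apply/matrixP => i j; rewrite !ord1 mulmx_dot mxE eqxx.
rewrite !scale_scalar_mx invmx_scalar mul_mx_scalar -?scalemxAl !scalerA.
congr (_ *: _).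
by field; rewrite dot_eq0 w0.
Qed.

Lemma orth_proj_line w : w != 0 ->
  orth_proj <[w]>%VS = (dot w w)^-1 *: (w *m w^T).
Proof.
move=> w0; have d1 : \dim <[w]>%VS = 1%N by rewrite dim_vline w0.
have i0 : (0 < \dim <[w]>%VS)%N by rewrite d1.
have b0 : (vbasis <[w]>%VS)`_0 \in <[w]>%VS.
  by apply: vbasis_mem; apply: mem_nth; rewrite size_tuple.
have [k bk] := vlineP _ _ b0.
have k0 : k != 0.
  have nz : (vbasis <[w]>%VS)`_0 != 0.
    by apply: (basis_not0 (vbasisP _)); apply: mem_nth; rewrite size_tuple.
  by apply: contraNneq nz => k0; rewrite bk k0 scale0r.
apply: (proj_mx_column (k := k)) => // i j; rewrite mxE.
have -> : nat_of_ord j = 0%N by case: j => -[//|j] /=; rewrite d1.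
by rewrite bk mxE.
Qed.

(** The compressed operator sends [y] to [dot w y / dot w w] times the part of
    [A w] orthogonal to [w]; by Cauchy-Schwarz the factor is largest, among the
    [y] in the unit ball, at the normalized [w]. *)
Lemma spectral_norm_line (A : 'M[R]_d) w : w != 0 ->
  let P := orth_proj <[w]>%VS in
  spectral_norm ((1%:M - P) *m A *m P) = line_dist (A *m w) w / eucl_norm w.
Proof.
move=> w0 P.
have Py y : P *m y = (dot w y / dot w w) *: w.
  rewrite /P orth_proj_line// -scalemxAl -mulmxA [w^T *m y]mx11_scalar.
  by rewrite mulmx_dot mul_mx_scalar scalerA mulrC.
have normE y : eucl_norm ((1%:M - P) *m A *m P *m y) =
    `|dot w y| / dot w w * line_dist (A *m w) w.
  rewrite -mulmxA Py -scalemxAr eucl_normZ -mulmxA mulmxBl mul1mx Py.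
  rewrite /line_dist /perp_part (dotC w (A *m w)) normrM normfV.
  by rewrite (ger0_norm (dot_ge0 w)).
have nw : 0 < eucl_norm w by rewrite eucl_norm_gt0.
set L := _ / _.
have ubL y : eucl_norm y <= 1 ->
    `|dot w y| / dot w w * line_dist (A *m w) w <= L.
  move=> y1; rewrite /L mulrC ler_wpM2l ?line_dist_ge0// -eucl_norm_sqr.
  rewrite ler_pdivrMr ?exprn_gt0// expr2 mulrA mulVf ?gt_eqF// mul1r.
  by apply: le_trans (cauchy_schwarz _ _) _; rewrite ler_piMr// ltW.
rewrite /spectral_norm; apply/eqP; rewrite eq_le; apply/andP; split.
  apply: ge_sup => [|_ [y /= y1 <-]]; last by rewrite normE ubL.
  exists (eucl_norm ((1%:M - P) *m A *m P *m 0)), 0 => //=.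
  by rewrite eucl_norm0.
apply: ub_le_sup; first by exists L => _ [y /= y1 <-]; rewrite normE ubL.
exists ((eucl_norm w)^-1 *: w) => /=.
  by rewrite eucl_normZ normfV (gtr0_norm nw) mulVf ?lt0r_neq0.
rewrite normE dotZr normrM ger0_norm ?invr_ge0 ?ltW// ger0_norm ?dot_ge0//.
by rewrite mulrC mulfK// dot_eq0.
Qed.

End LineProjector.

(** * Ranges between lower and upper limits *)

Section LimitRanges.
Context {R : realType}.

(** A comparison of tails of functions on different index sets (below: real
    times against step numbers). It controls the upper limit of [a] from above
    and its lower limit from below by those of [b]. *)
Definition tail_close {S T : Type} (F : set_system S) (G : set_system T)
    (a : S -> R) (b : T -> R) (e : R) : Prop :=
  forall V, G V -> exists2 W, F W &
    forall s, W s -> exists2 t, V t & `|a s - b t| <= e.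

Lemma tail_closeN {S T : Type} (F : set_system S) (G : set_system T)
    (a : S -> R) (b : T -> R) (e : R) :
  tail_close F G a b e -> tail_close F G (fun s => - a s) (fun t => - b t) e.
Proof.
move=> ab V /ab[W FW Wab]; exists W => // s /Wab[t Vt st]; exists t => //.
by rewrite -opprD normrN.
Qed.

Lemma limf_esup_tail_close {S T : topologicalType} (F : set_system S)
    (G : set_system T) (a : S -> R) (b : T -> R) (e : R) :
  tail_close F G a b e ->
  (limf_esup (fun s => (a s)%:E) F <= limf_esup (fun t => (b t)%:E) G + e%:E)%E.
Proof.
move=> ab; rewrite -leeBlDr//; apply: le_ereal_inf_tmp => _ [V GV <-].
have [W FW Wab] := ab V GV; rewrite leeBlDr//.
apply: (@le_trans _ _ (ereal_sup ((fun s => (a s)%:E) @` W))).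
  by apply: ereal_inf_lbound; exists W.
apply: ge_ereal_sup => _ [s Ws <-]; have [t Vt] := Wab s Ws.
rewrite ler_norml => /andP[_ st].
apply: (@le_trans _ _ ((b t)%:E + e%:E)%E).
  by rewrite -EFinD lee_fin; lra.
by rewrite leeD2r//; apply: ereal_sup_ubound; exists t.
Qed.

Lemma limf_einf_tail_close {S T : topologicalType} (F : set_system S)
    (G : set_system T) (a : S -> R) (b : T -> R) (e : R) :
  tail_close F G a b e ->
  (limf_einf (fun t => (b t)%:E) G <= limf_einf (fun s => (a s)%:E) F + e%:E)%E.
Proof.
move=> /tail_closeN/limf_esup_tail_close; rewrite /limf_einf => ab.
by rewrite -leeBlDr// -fin_num_oppeD// leeN2.
Qed.

Lemma limf_einf_le_esup {T : topologicalType} (F : set_system T)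
    (a : T -> \bar R) :
  ProperFilter F -> (limf_einf a F <= limf_esup a F)%E.
Proof.
move=> PF; rewrite limf_einfE; apply: ge_ereal_sup => _ [V FV <-].
apply: le_ereal_inf_tmp => _ [W FW <-].
have [t [Vt Wt]] := filter_ex (filterI FV FW).
apply: (@le_trans _ _ (a t)); first by apply: ereal_inf_lbound; exists t.
by apply: ereal_sup_ubound; exists t.
Qed.

Lemma limf_fin_num {T : topologicalType} (F : set_system T) (a : T -> R)
    (B : R) :
  ProperFilter F -> (\forall t \near F, `|a t| <= B) ->
  (limf_einf (fun t => (a t)%:E) F \is a fin_num) *
  (limf_esup (fun t => (a t)%:E) F \is a fin_num).
Proof.
move=> PF aB; have is_le := @limf_einf_le_esup _ F (fun t => (a t)%:E) PF.
have lB : ((- B)%:E <= limf_einf (fun t => (a t)%:E) F)%E.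
  rewrite limf_einfE; apply: le_trans (ereal_sup_ubound _); last first.
    by exists [set t | `|a t| <= B].
  by apply: le_ereal_inf_tmp => _ [t /= + <-]; rewrite ler_norml => /andP[].
have uB : (limf_esup (fun t => (a t)%:E) F <= B%:E)%E.
  apply: le_trans (ereal_inf_lbound _) _; first by exists [set t | `|a t| <= B].
  by apply: ge_ereal_sup => _ [t /= + <-]; rewrite ler_norml => /andP[].
split; rewrite fin_real//; apply/andP; split.
- exact: lt_le_trans (ltNyr _) lB.
- exact: le_lt_trans (le_trans is_le uB) (ltry _).
- exact: lt_le_trans (ltNyr _) (le_trans lB is_le).
- exact: le_lt_trans uB (ltry _).
Qed.

Lemma edist_le (x y e : R) :
  0 <= e -> `|x - y| <= e -> (edist (x, y) <= e%:E)%E.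
Proof.
move=> e0 xy; apply/lee_addgt0Pr => r r0; rewrite -EFinD.
apply: edist_fin => /=; first exact: ltr_wpDl.
by rewrite /ball/=; apply: le_lt_trans xy _; rewrite ltrDl.
Qed.

(** Each point of [X] is moved into [Y] by clamping it to the interval [Y]. *)
Lemma edist_inf_itv (l1 u1 l2 u2 e : R) (X Y : set R) : 0 <= e -> l2 <= u2 ->
  X `<=` `[l1, u1] -> `[l2, u2] `<=` Y -> l2 <= l1 + e -> u1 <= u2 + e ->
  (ereal_sup [set edist_inf Y a | a in X] <= e%:E)%E.
Proof.
move=> e0 lu XS SY ll uu; apply: ge_ereal_sup => _ [a /XS + <-].
rewrite /= in_itv/= => /andP[la au].
pose b := Num.max l2 (Num.min a u2).
have Yb : Y b.
  apply: SY; rewrite /= in_itv/= /b le_max lexx/= ge_max lu/=.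
  by rewrite ge_min lexx orbT.
apply: (@le_trans _ _ (edist (a, b))).
  by apply: ereal_inf_lbound; exists b.
apply: edist_le => //; rewrite /b ler_norml.
case: (leP a u2) => au2.
  by case: (leP l2 a) => l2a; apply/andP; split; lra.
by rewrite max_r//; apply/andP; split; lra.
Qed.

(** Both ranges are nonempty compact intervals whose corresponding endpoints lie
    within [e] of each other. *)
Lemma hausdorff_dist_limit_ranges {S T : topologicalType} (F : set_system S)
    (G : set_system T) (a : S -> R) (b : T -> R) (e B : R) :
  ProperFilter F -> ProperFilter G -> 0 <= e ->
  (\forall s \near F, `|a s| <= B) -> (\forall t \near G, `|b t| <= B) ->
  tail_close F G a b e -> tail_close G F b a e ->
  (hausdorff_dist
    [set y : R | (limf_einf (fun s => (a s)%:E) F <= y%:E)%E /\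
                 (y%:E <= limf_esup (fun s => (a s)%:E) F)%E]
    [set y : R | (limf_einf (fun t => (b t)%:E) G <= y%:E)%E /\
                 (y%:E <= limf_esup (fun t => (b t)%:E) G)%E] <= e%:E)%E.
Proof.
move=> PF PG e0 aB bB ab ba.
have [fa1 fa2] := limf_fin_num PF aB; have [fb1 fb2] := limf_fin_num PG bB.
have := limf_einf_le_esup (fun s => (a s)%:E) PF.
have := limf_einf_le_esup (fun t => (b t)%:E) PG.
have := limf_esup_tail_close ab; have := limf_esup_tail_close ba.
have := limf_einf_tail_close ab; have := limf_einf_tail_close ba.
rewrite -(fineK fa1) -(fineK fa2) -(fineK fb1) -(fineK fb2).
move: (fine _) (fine _) (fine _) (fine _) => ua ub lb la.
rewrite -!EFinD !lee_fin => h1 h2 h3 h4 h5 h6.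
have E (l u : R) :
    [set y : R | (l%:E <= y%:E)%E /\ (y%:E <= u%:E)%E] = `[l, u]%classic.
  apply/seteqP; split=> y /=; rewrite in_itv/= !lee_fin; first by case=> -> ->.
  by move=> /andP.
rewrite !E /hausdorff_dist ge_max; apply/andP; split.
- exact: (@edist_inf_itv la ua lb ub).
- exact: (@edist_inf_itv lb ub la ua).
Qed.

End LimitRanges.

(** * The Jacobian along a bounded trajectory *)

Section JacobianAlongTrajectory.
Context {R : realType} {d : nat}.

Lemma trmx_continuous m n : continuous (@trmx R m n).
Proof.
move=> M s /= /(nbhs_ballP M^T) [e e0 es].
apply/nbhs_ballP; exists e => //= N [e1 MN]; apply: es.
by split=> // i j; rewrite !mxE; exact: MN.
Qed.

Lemma continuous_entry {m n} (F : 'cV[R]_d -> 'M[R]_(m, n)) i j :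
  continuous F -> continuous (fun p => F p i j).
Proof.
move=> cF p; have cij := @coord_continuous R m n i j (F p).
have := cvg_comp _ _ (cF p) cij; exact.
Qed.

(** The ball lies in a cube, which is compact as a product of segments; this is
    available for row vectors and carried over by transposition. *)
Lemma continuous_bounded_on_ball (F : 'cV[R]_d -> R) (M : R) :
  continuous F -> exists B, forall p, eucl_norm p <= M -> `|F p| <= B.
Proof.
move=> cF.
pose box := [set v : 'rV[R]_d | forall i, `[- M, M]%classic (v ord0 i)].
have cbox : compact box.
  apply: (@rV_compact _ _ (fun=> `[- M, M]%classic)) => i.
  exact: segment_compact.
have cimg : compact ((F \o trmx) @` box).
  apply: continuous_compact => //; apply: continuous_subspaceT => v.
  by apply: continuous_comp; [exact: trmx_continuous|exact: cF].
have [B [_ HB]] := compact_bounded cimg.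
exists (B + 1) => p pM; apply: HB; first by rewrite ltrDl.
exists p^T; last by rewrite /= trmxK.
move=> i; rewrite /= in_itv/= mxE -ler_norml.
exact: le_trans (ler_coord_eucl_norm p i) pM.
Qed.

Lemma diff_jac (f : 'cV[R]_d -> 'cV[R]_d) p v :
  differentiable f p -> 'd f p v = jac f p *m v.
Proof.
move=> df; rewrite [in LHS](matrix_sum_delta v).
rewrite linear_sum; apply/matrixP => i j; rewrite summxE ord1 mxE.
by apply: eq_bigr => k _; rewrite big_ord1 linearZ !mxE deriveE// mulrC !ord1.
Qed.

Variables (f : 'cV[R]_d -> 'cV[R]_d) (x : R -> 'cV[R]_d).
Hypothesis x_sol : ode_solution f x.

Lemma entry_deriv_comp {m n} (F : 'cV[R]_d -> 'M[R]_(m, n)) :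
  (forall p, differentiable F p) ->
  entry_deriv (fun t => F (x t)) (fun t => 'd F (x t) (f (x t))).
Proof.
move=> dF i j; split.
  have /has_tderiv_cvg0 c := x_sol (lexx 0).
  have cF : {for x 0, continuous F} by exact: differentiable_continuous.
  have cij := @coord_continuous R m n i j (F (x 0)).
  have c1 := cvg_comp _ _ c cF.
  have c2 := cvg_comp _ _ c1 cij; exact: c2.
move=> t t0; apply: is_derive_coord.
have dx : is_derive t 1 x (f (x t)).
  by apply: has_tderiv_is_derive => //; apply: x_sol; exact: ltW.
have xt : differentiable x t by apply/derivable1_diffP; exact: ex_derive.
have dFx : differentiable (F \o x) t by exact: differentiable_comp.
apply: DeriveDef; first exact: diff_derivable.
have E : 'd x t 1 = f (x t).
  by rewrite -deriveE//; exact: (@derive_val _ _ _ _ _ _ _ dx).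
by rewrite deriveE// diff_comp//= E.
Qed.

Hypothesis x_bounded : bounded_traj x.

Lemma traj_continuous_bounded (F : 'cV[R]_d -> R) :
  continuous F -> exists2 B, 0 <= B & forall t, 0 <= t -> `|F (x t)| <= B.
Proof.
move=> cF; have [M xM] := x_bounded.
have [B FB] := continuous_bounded_on_ball M cF.
exists (Num.max 0 B) => [|t t0]; first by rewrite le_max lexx.
by rewrite le_max FB ?orbT// xM.
Qed.

Lemma traj_entries_bounded {m n} (F : 'cV[R]_d -> 'M[R]_(m, n)) :
  continuous F ->
  exists2 B, 0 <= B & forall t, 0 <= t -> forall i j, `|F (x t) i j| <= B.
Proof.
move=> cF.
have /choice[B HB] : forall ij : 'I_m * 'I_n, exists B, 0 <= B /\
    forall t, 0 <= t -> `|F (x t) ij.1 ij.2| <= B.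
  move=> ij.
  have [|B B0 HB] := @traj_continuous_bounded (fun p => F p ij.1 ij.2).
    exact: continuous_entry.
  by exists B.
exists (\sum_ij B ij) => [|t t0 i j].
  by apply: sumr_ge0 => ij _; case: (HB ij).
apply: le_trans ((HB (i, j)).2 t t0) _; rewrite (bigD1 (i, j))//= lerDl.
by apply: sumr_ge0 => ij _; case: (HB ij).
Qed.

Lemma mulmx_eucl_norm_le (M : 'M[R]_d) (v : 'cV[R]_d) (B : R) :
  (forall i j, `|M i j| <= B) ->
  eucl_norm (M *m v) <= (d%:R * d%:R * B) * eucl_norm v.
Proof.
move=> MB; apply: le_trans (ler_eucl_norm_sum _) _.
have : \sum_(i < d) `|(M *m v) i ord0| <=
    \sum_(i < d) \sum_(j < d) B * eucl_norm v.
  apply: ler_sum => i _; rewrite mxE; apply: le_trans (ler_norm_sum _ _ _) _.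
  apply: ler_sum => j _; rewrite normrM ler_pM//; exact: ler_coord_eucl_norm.
rewrite !sumr_const !card_ord -(mulr_natl (B * _)) -(mulr_natl (d%:R * _)).
by rewrite !mulrA.
Qed.

Hypothesis f_C2 : class_C2 f.

Let v t := f (x t).
Let A t := jac f (x t).

Lemma entry_deriv_traj : entry_deriv x v.
Proof. exact: has_tderiv_entry. Qed.

(** The velocity solves the variational equation. *)
Lemma entry_deriv_velocity : entry_deriv v (fun t => A t *m v t).
Proof.
have [df _ _] := f_C2; move=> i j; have := entry_deriv_comp df i j.
by apply: half_deriv_ext => t _; rewrite diff_jac.
Qed.

(** The trajectory stays in a ball, on which [jac f] is bounded. *)
Lemma generator_bounded : exists2 L, 0 <= L &
  forall t (w : 'cV[R]_d), 0 <= t -> eucl_norm (A t *m w) <= L * eucl_norm w.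
Proof.
have [_ dj _] := f_C2.
have [|B B0 HB] := @traj_entries_bounded _ _ (jac f).
  by move=> p; exact: differentiable_continuous.
exists (d%:R * d%:R * B) => [|t w t0]; first by rewrite !mulr_ge0.
by apply: mulmx_eucl_norm_le; exact: HB.
Qed.

(** Along the trajectory [jac f] has derivative ['d (jac f) (x t) (f (x t))]. By
    linearity it is controlled by the finitely many continuous maps
    ['d (jac f) p (delta_mx k ord0)], which are bounded on the ball containing
    the trajectory. This is where the second derivative of [f] enters. *)
Lemma generator_lipschitz : exists2 K, 0 <= K &
  forall s t (w : 'cV[R]_d), 0 <= s -> 0 <= t ->
  eucl_norm ((A s - A t) *m w) <= K * `|s - t| * eucl_norm w.
Proof.
have [df dj cdj] := f_C2.
have [|V V0 HV] := @traj_entries_bounded _ _ f.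
  by move=> p; exact: differentiable_continuous.
have /choice[B HB] : forall k : 'I_d, exists B, 0 <= B /\
    forall t, 0 <= t -> forall i j,
    `|'d (jac f) (x t) (delta_mx k ord0) i j| <= B.
  move=> k; have [B B0 HB] := traj_entries_bounded (cdj (delta_mx k ord0)).
  by exists B.
pose K := \sum_k V * B k.
have K0 : 0 <= K by apply: sumr_ge0 => k _; rewrite mulr_ge0//; case: (HB k).
have dA : entry_deriv A (fun t => 'd (jac f) (x t) (v t)).
  exact: entry_deriv_comp.
have dAK t i j : 0 <= t -> `|'d (jac f) (x t) (v t) i j| <= K.
  move=> t0; rewrite (matrix_sum_delta (v t)) linear_sum summxE.
  apply: le_trans (ler_norm_sum _ _ _) _; apply: ler_sum => k _.
  rewrite big_ord1 linearZ mxE normrM ler_pM//; first exact: HV.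
  exact: (HB k).2.
have lipA s t i j : 0 <= s -> 0 <= t -> `|A s i j - A t i j| <= K * `|s - t|.
  wlog ts : s t / t <= s => [hw s0 t0|s0 t0].
    have [|/ltW] := leP t s; first by move=> ?; exact: hw.
    by move=> st; rewrite distrC (distrC s); exact: hw.
  rewrite (ger0_norm (_ : 0 <= s - t)) ?subr_ge0//.
  apply: (half_deriv_bound (dA i j)) => // c /andP[tc _]; apply: dAK.
  exact: le_trans tc.
exists (d%:R * d%:R * K) => [|s t w s0 t0]; first by rewrite !mulr_ge0.
rewrite -[_ * _ * K * `|_|]mulrA; apply: mulmx_eucl_norm_le => i j.
have -> : (A s - A t) i j = A s i j - A t i j by rewrite mxE [X in _ + X]mxE.
exact: lipA.
Qed.

End JacobianAlongTrajectory.

(** * The angle between consecutive steps *)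

Section Perturbation.
Context {R : realType} {d : nat}.
Implicit Types a b p q : 'cV[R]_d.

(** Closeness of [p] to [q] bounds [|p|] from below, which allows both signs of
    the difference to be estimated with [|q|] as the only denominator. *)
Lemma line_dist_lipr b p q : q != 0 ->
  eucl_norm (p - q) <= eucl_norm q / 2 ->
  `|line_dist b p - line_dist b q| <=
    2 * (eucl_norm b / eucl_norm q) * eucl_norm (p - q).
Proof.
move=> q0 pq; have nq : 0 < eucl_norm q by rewrite eucl_norm_gt0.
have np : eucl_norm q / 2 <= eucl_norm p.
  by have := ler_eucl_normD (q - p) p; rewrite subrK eucl_norm_distC; lra.
have np0 : 0 < eucl_norm p by lra.
have p0 : p != 0 by rewrite -eucl_norm_gt0.
have h1 := line_dist_le_subr b p q0; have := line_dist_le_subr b q p0.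
rewrite (eucl_norm_distC q) => h2.
have nb := eucl_norm_ge0 b; have npq := eucl_norm_ge0 (p - q).
have c0 : 0 <= eucl_norm b / eucl_norm q by rewrite divr_ge0// ltW.
have c1 : eucl_norm b / eucl_norm p <= 2 * (eucl_norm b / eucl_norm q).
  rewrite mulrCA ler_wpM2l// -[leRHS]invrK lef_pV2 ?posrE ?invr_gt0 ?mulr_gt0//.
    by rewrite invfM invrK mulrC.
  by rewrite invr_gt0.
have := ler_wpM2r npq c1.
have : eucl_norm b / eucl_norm q * eucl_norm (p - q) <=
  2 * (eucl_norm b / eucl_norm q) * eucl_norm (p - q).
  by rewrite ler_wpM2r//; lra.
rewrite ler_norml; lra.
Qed.

(** All perturbations are measured relative to [|q|], so that the estimate
    does not degenerate along trajectories whose speed tends to zero. The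
    denominator [m] is kept apart from [|p|]: the sine of the angle between [p]
    and [p'] is [line_dist p' p / |p'|]. *)
Lemma line_dist_ratio_close a b p q (m eta kappa L : R) : q != 0 ->
  0 <= eta <= 1 / 2 -> 0 <= L ->
  eucl_norm (p - q) <= eta * eucl_norm q ->
  `|m - eucl_norm q| <= eta * eucl_norm q ->
  eucl_norm b <= L * eucl_norm q ->
  eucl_norm (a - b) <= kappa * eucl_norm q ->
  `|line_dist a p / m - line_dist b q / eucl_norm q| <=
    2 * kappa + 6 * L * eta.
Proof.
move=> q0 /andP[e0 e1] L0 pq mq bq ab.
set n := eucl_norm q in pq mq bq ab *.
have n0 : 0 < n by rewrite eucl_norm_gt0.
have en : eta * n <= n / 2 by rewrite mulrC ler_wpM2l ?(ltW n0)//; lra.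
have m2 : n / 2 <= m by move: mq; rewrite ler_norml; lra.
have m0 : 0 < m by lra.
have h1 := le_trans (line_dist_lipl a b p) ab.
have h2 : `|line_dist b p - line_dist b q| <= 2 * L * (eta * n).
  apply: le_trans (line_dist_lipr b q0 _) _; first exact: le_trans pq en.
  rewrite ler_pM ?eucl_norm_ge0//.
    by rewrite mulr_ge0// divr_ge0 ?eucl_norm_ge0.
  by rewrite ler_wpM2l// ler_pdivrMr.
have h3 : `|line_dist a p - line_dist b q| <= (kappa + 2 * L * eta) * n.
  rewrite -(subrK (line_dist b p) (line_dist a p)) -addrA.
  by apply: le_trans (ler_normD _ _) _; lra.
have k0 : 0 <= kappa + 2 * L * eta.
  by rewrite -(pmulr_lge0 _ n0); exact: le_trans (normr_ge0 _) h3.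
have Db : line_dist b q / n <= L.
  by rewrite ler_pdivrMr//; apply: le_trans (line_dist_le_norm _ _) _.
have Db0 : 0 <= line_dist b q / n by rewrite divr_ge0 ?line_dist_ge0// ltW.
have -> : line_dist a p / m - line_dist b q / n =
    ((line_dist a p - line_dist b q) + line_dist b q / n * (n - m)) / m.
  by field; rewrite !gt_eqF.
rewrite normrM normfV (gtr0_norm m0) ler_pdivrMr//.
apply: le_trans (ler_normD _ _) _; rewrite normrM (ger0_norm Db0) (distrC n).
have h4 : line_dist b q / n * `|m - n| <= L * (eta * n) by rewrite ler_pM.
have h5 : (2 * kappa + 6 * L * eta) * (n / 2) <= (2 * kappa + 6 * L * eta) * m.
  rewrite ler_wpM2l//; have : 0 <= L * eta by rewrite mulr_ge0.
  lra.
lra.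
Qed.

End Perturbation.

Section SteppedTrajectory.
Context {R : realType} {d : nat} (x v a : R -> 'cV[R]_d) (L K E : R).
Hypotheses (L0 : 0 <= L) (K0 : 0 <= K) (E0 : 0 <= E).
Hypotheses (dx : entry_deriv x v) (dv : entry_deriv v a).
Hypothesis v_neq0 : forall t, 0 <= t -> v t != 0.
Hypothesis a_le : forall t, 0 <= t -> eucl_norm (a t) <= L * eucl_norm (v t).
Hypothesis v_le : forall s t, 0 <= s -> 0 <= t -> `|s - t| <= 1 ->
  eucl_norm (v s) <= E * eucl_norm (v t).
Hypothesis a_lip : forall s t, 0 <= s -> 0 <= t -> `|s - t| <= 1 ->
  eucl_norm (a s - a t) <= K * `|s - t| * eucl_norm (v t).

Let V t := eucl_norm (v t).

Lemma velocity_taylor0 s t : 0 <= s -> 0 <= t -> `|s - t| <= 1 ->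
  eucl_norm (v s - v t) <= L * E * `|s - t| * V t.
Proof.
move=> s0 t0 st; rewrite mulrAC.
apply: (entry_deriv_lip dv) => // r r0 rt.
apply: le_trans (a_le r0) _; rewrite -mulrA ler_wpM2l//.
by apply: v_le => //; exact: le_trans rt st.
Qed.

(** The derivative of the remainder in [s] is [a s - a t]: the Lipschitz bound
    on [a] replaces a second derivative of [v]. *)
Lemma velocity_taylor1 s t : 0 <= s -> 0 <= t -> `|s - t| <= 1 ->
  eucl_norm (v s - v t - (s - t) *: a t) <= K * `|s - t| ^+ 2 * V t.
Proof.
move=> s0 t0 st.
have dw : entry_deriv (fun r => v r - (r - t) *: a t)
    (fun r => a r - (1 - 0) *: a t).
  apply: entry_derivB dv _; apply: entry_deriv_scale.
  exact: half_derivB half_deriv_id (half_deriv_cst t).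
have := @entry_deriv_lip _ _ _ _ (K * `|s - t| * V t) s t dw s0 t0.
rewrite subrr scale0r subr0 subr0 scale1r addrAC => h.
rewrite expr2 mulrA mulrAC; apply: h => r r0 rt.
apply: le_trans (a_lip r0 t0 (le_trans rt st)) _.
by rewrite ler_wpM2r ?eucl_norm_ge0// ler_wpM2l.
Qed.

Lemma position_taylor1 s t : 0 <= s -> 0 <= t -> `|s - t| <= 1 ->
  eucl_norm (x s - x t - (s - t) *: v t) <= L * E * `|s - t| ^+ 2 * V t.
Proof.
move=> s0 t0 st.
have dw : entry_deriv (fun r => x r - (r - t) *: v t)
    (fun r => v r - (1 - 0) *: v t).
  apply: entry_derivB dx _; apply: entry_deriv_scale.
  exact: half_derivB half_deriv_id (half_deriv_cst t).
have := @entry_deriv_lip _ _ _ _ (L * E * `|s - t| * V t) s t dw s0 t0.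
rewrite subrr scale0r subr0 subr0 scale1r addrAC => h.
rewrite expr2 [L * E * _]mulrA mulrAC; apply: h => r r0 rt.
apply: le_trans (velocity_taylor0 r0 t0 (le_trans rt st)) _.
by rewrite ler_wpM2r ?eucl_norm_ge0// ler_wpM2l// mulr_ge0.
Qed.

(** The remainder has as its derivative in [s] the remainder of
    [velocity_taylor1], so the mean value inequality gains one power of
    [|s - t|] over it. *)
Lemma position_taylor2 s t : 0 <= s -> 0 <= t -> `|s - t| <= 1 ->
  eucl_norm (x s - x t - (s - t) *: v t - ((s - t) ^+ 2 / 2) *: a t) <=
    K * `|s - t| ^+ 3 * V t.
Proof.
move=> s0 t0 st.
have dk := half_derivB (@half_deriv_id R) (half_deriv_cst t).
have dk2 := half_derivZ (2^-1) (half_derivM dk dk).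
have dw := entry_derivB (entry_derivB dx (entry_deriv_scale (v t) dk))
  (entry_deriv_scale (a t) dk2).
have := @entry_deriv_lip _ _ _ _ (K * `|s - t| ^+ 2 * V t) s t dw s0 t0.
rewrite /= subrr !scale0r mulr0 mulr0 scale0r !subr0.
have -> : x s - (s - t) *: v t - (2^-1 * ((s - t) * (s - t))) *: a t - x t =
    x s - x t - (s - t) *: v t - ((s - t) ^+ 2 / 2) *: a t.
  by rewrite expr2 [2^-1 * _]mulrC addrAC (addrAC (x s)).
have -> : K * `|s - t| ^+ 3 * V t = K * `|s - t| ^+ 2 * V t * `|s - t| by ring.
move=> h; apply: h => r r0 rt.
have -> : (2^-1 * ((r - t) * 1 + 1 * (r - t))) = r - t by field.
rewrite scale1r; apply: le_trans (velocity_taylor1 r0 t0 (le_trans rt st)) _.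
by rewrite ler_wpM2r ?eucl_norm_ge0// ler_wpM2l// lerXn2r ?nnegrE.
Qed.

(** This is the norm of the derivative of [v / |v|] when [a] is the derivative
    of [v]. *)
Definition turning_speed (t : R) : R := line_dist (a t) (v t) / eucl_norm (v t).

Lemma turning_speed_bounds t : 0 <= t -> 0 <= turning_speed t <= L.
Proof.
move=> t0; rewrite divr_ge0 ?line_dist_ge0 ?eucl_norm_ge0//=.
rewrite ler_pdivrMr ?eucl_norm_gt0 ?v_neq0//.
exact: le_trans (line_dist_le_norm _ _) (a_le t0).
Qed.

Lemma turning_speed_lip s t : 0 <= s -> 0 <= t -> `|s - t| <= 1 ->
  L * E * `|s - t| <= 1 / 2 ->
  `|turning_speed s - turning_speed t| <=
    (2 * K + 6 * L * (L * E)) * `|s - t|.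
Proof.
move=> s0 t0 st st'.
have -> : (2 * K + 6 * L * (L * E)) * `|s - t| =
  2 * (K * `|s - t|) + 6 * L * (L * E * `|s - t|) by ring.
apply: line_dist_ratio_close => //.
- exact: v_neq0.
- by rewrite st' !mulr_ge0.
- exact: velocity_taylor0.
- apply: le_trans (ler_eucl_dist _ _) _; exact: velocity_taylor0.
- exact: a_le.
- exact: a_lip.
Qed.

(** Write [p] and [q] for the difference quotients of [x] before and after [t].
    They are [O(h |v t|)]-close to [v t], while
    [q - p = h a(t) + O(h ^+ 2 |v t|)]. Adding a multiple of [p] does not change
    the distance to the line of [p], so the sine of the angle is
    [line_dist (q - p) p / |q|], that is, [h line_dist (a t) (v t) / |v t|] up
    to [O(h ^+ 2)]. *)
Lemma angle_step t h : 0 < h -> h <= 1 -> L * E * h <= 1 / 2 -> h <= t ->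
  `|angle (x (t - h) - x t) (x t - x (t + h)) - h * turning_speed t| <=
    (4 * K + 6 * L * (L * E) + 2 * (L + (4 * K + 6 * L * (L * E))) ^+ 2) *
    h ^+ 2.
Proof.
move=> h0 h1 hE ht; set C := 4 * K + 6 * L * (L * E).
have t0 : 0 <= t by lra.
have th0 : 0 <= t - h by lra.
have th0' : 0 <= t + h by lra.
have nh : `|h| = h by rewrite gtr0_norm.
have e1 : t - h - t = - h by ring.
have e2 : t + h - t = h by ring.
have hn0 : h != 0 by rewrite gt_eqF.
have V0 : 0 < V t by rewrite /V eucl_norm_gt0 v_neq0.
pose p := h^-1 *: (x t - x (t - h)).
pose q := h^-1 *: (x (t + h) - x t).
have hV : h^-1 * (L * E * h ^+ 2 * V t) = L * E * h * V t by field.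
have pv : eucl_norm (p - v t) <= L * E * h * V t.
  have -> : p - v t = - (h^-1 *: (x (t - h) - x t - (t - h - t) *: v t)).
    rewrite e1 scaleNr opprK scalerDr scalerA mulVf// scale1r opprD.
    by rewrite -scalerN opprB.
  rewrite eucl_normN eucl_normZ normfV nh -hV ler_wpM2l ?invr_ge0 ?(ltW h0)//.
  by have := @position_taylor1 (t - h) t; rewrite e1 normrN nh; apply.
have qv : eucl_norm (q - v t) <= L * E * h * V t.
  have -> : q - v t = h^-1 *: (x (t + h) - x t - (t + h - t) *: v t).
    by rewrite e2 scalerBr scalerA mulVf// scale1r.
  rewrite eucl_normZ normfV nh -hV ler_wpM2l ?invr_ge0 ?(ltW h0)//.
  by have := @position_taylor1 (t + h) t; rewrite e2 nh; apply.
pose a' := h^-1 *: (q - p).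
have aa : eucl_norm (a' - a t) <= 2 * K * h * V t.
  have -> : a' - a t = (h^-1 * h^-1) *:
     ((x (t + h) - x t - (t + h - t) *: v t - ((t + h - t) ^+ 2 / 2) *: a t) +
     (x (t - h) - x t - (t - h - t) *: v t - ((t - h - t) ^+ 2 / 2) *: a t)).
    rewrite e1 e2 /a' /p /q; apply/matrixP => i j; rewrite !mxE.
    by field.
  rewrite eucl_normZ normrM normfV nh.
  have -> : 2 * K * h * V t = h^-1 * h^-1 *
      (K * h ^+ 3 * V t + K * h ^+ 3 * V t) by field.
  rewrite ler_wpM2l ?mulr_ge0 ?invr_ge0 ?(ltW h0)//.
  apply: le_trans (ler_eucl_normD _ _) _; apply: lerD.
    by have := @position_taylor2 (t + h) t; rewrite e2 nh; apply.
  by have := @position_taylor2 (t - h) t; rewrite e1 normrN nh; apply.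
have VE : L * E * h * V t <= V t / 2.
  by rewrite mulrC ler_wpM2l ?(ltW V0)//; lra.
have p0 : p != 0.
  rewrite -eucl_norm_gt0; have := ler_eucl_normD (v t - p) p.
  by rewrite subrK eucl_norm_distC -/(V t); lra.
have q0 : q != 0.
  rewrite -eucl_norm_gt0; have := ler_eucl_normD (v t - q) q.
  by rewrite subrK eucl_norm_distC -/(V t); lra.
have -> : angle (x (t - h) - x t) (x t - x (t + h)) = angle p q.
  have -> : x (t - h) - x t = - h *: p.
    by rewrite scaleNr scalerA divff// scale1r opprB.
  have -> : x t - x (t + h) = - h *: q.
    by rewrite scaleNr scalerA divff// scale1r opprB.
  by rewrite angle_scale ?oppr_eq0.
pose S := line_dist q p / eucl_norm q.
have /andP[lo hi] := angle_sin_bounds p0 q0; rewrite -/S in lo hi.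
have ratio : `|line_dist a' p / eucl_norm q - turning_speed t| <= C * h.
  have := @line_dist_ratio_close R d a' (a t) p (v t) (eucl_norm q)
    (L * E * h) (2 * K * h) L.
  have -> : 2 * (2 * K * h) + 6 * L * (L * E * h) = C * h by rewrite /C; ring.
  apply => //.
  - exact: v_neq0.
  - by rewrite hE !mulr_ge0// (ltW h0).
  - exact: le_trans (ler_eucl_dist _ _) qv.
  - exact: a_le.
have SE : S = h * (line_dist a' p / eucl_norm q).
  rewrite /S /a' (line_distZ _ (q - p)) normfV nh.
  rewrite -[h^-1 * _ / _]mulrA mulVKf//.
  by congr (_ / _); rewrite -[in LHS](subrK p q) line_distDl.
have Sg : `|S - h * turning_speed t| <= C * h ^+ 2.
  have -> : C * h ^+ 2 = h * (C * h) by ring.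
  by rewrite SE -mulrBr normrM nh ler_wpM2l// (ltW h0).
have /andP[g0 gL] := turning_speed_bounds t0.
have C0 : 0 <= C by rewrite /C addr_ge0 ?mulr_ge0.
have S0 : 0 <= S by rewrite /S divr_ge0 ?line_dist_ge0 ?eucl_norm_ge0.
have hL : h * turning_speed t <= h * L by rewrite ler_wpM2l// (ltW h0).
have hh : C * h ^+ 2 <= C * h by rewrite ler_wpM2l// expr2 ler_piMl// (ltW h0).
have SL : S <= (L + C) * h by move: Sg; rewrite ler_norml => /andP[_]; lra.
have S2 : S ^+ 2 <= (L + C) ^+ 2 * h ^+ 2.
  by rewrite -exprMn lerXn2r// nnegrE (le_trans S0).
move: Sg; rewrite !ler_norml => /andP[g1 g2].
have h6 : 0 <= 2 * (L + C) ^+ 2 * h ^+ 2.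
  by rewrite -mulrA -exprMn mulr_ge0 ?sqr_ge0.
by apply/andP; split; lra.
Qed.

End SteppedTrajectory.

(** * Averages of Riemann sums and integrals *)

Section Averages.
Context {R : realType}.

(** The primitive is handled through its derivative only, so that integrals over
    subintervals are estimated by the mean value theorem. *)
Lemma half_deriv_integral (g : R -> R) : continuous g ->
  half_deriv (fun T => \int[lebesgue_measure]_(t in `[0, T]) g t) g.
Proof.
move=> cg.
have ig (T : R) : lebesgue_measure.-integrable `[0, T] (EFin \o g).
  apply: continuous_compact_integrable; first exact: segment_compact.
  exact: continuous_subspaceT.
split.
  rewrite set_itv1 Rintegral_set1; apply: cvg_at_right_filter.
  exact: (parameterized_integral_cvg_left ltr01 (ig 1)).
move=> t t0; have tt : t < t + 1 by rewrite ltrDl.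
have [dJ EJ] := continuous_FTC1_closed tt (ig _) t0 (cg t).
by apply: DeriveDef => //; rewrite -derive1E.
Qed.

Context (g J : R -> R) (theta : nat -> R) (L G C h : R).
Hypotheses (L0 : 0 <= L) (h0 : 0 < h).
Hypotheses (dJ : half_deriv J g) (J0 : J 0 = 0).
Hypothesis g_le : forall t, 0 <= t -> `|g t| <= L.
Hypothesis g_lip : forall s t, 0 <= s -> 0 <= t -> `|s - t| <= h ->
  `|g s - g t| <= G * h.
Hypothesis theta_close : forall j, (0 < j)%N ->
  `|theta j - h * g (j%:R * h)| <= C * h ^+ 2.

Definition time_average (T : R) : R := T^-1 * J T.
Definition step_average (N : nat) : R :=
  (N%:R * h)^-1 * \sum_(1 <= j < N.+1) theta j.

Lemma primitive_le s t : 0 <= s -> s <= t -> `|J t - J s| <= L * (t - s).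
Proof.
move=> s0 st; apply: (half_deriv_bound dJ s0 st) => c /andP[sc _].
by apply: g_le; exact: le_trans sc.
Qed.

Lemma primitive_step t : h <= t -> `|J t - J (t - h) - h * g t| <= G * h ^+ 2.
Proof.
move=> ht; have th0 : 0 <= t - h by rewrite subr_ge0.
have le_th : t - h <= t by rewrite gerBl ltW.
have dw := half_derivB dJ (half_derivZ (g t) (@half_deriv_id R)).
have := @half_deriv_bound _ _ _ _ _ (G * h) dw th0 le_th.
rewrite /= mulr1.
have -> : G * h * (t - (t - h)) = G * h ^+ 2 by ring.
have -> : J t - g t * t - (J (t - h) - g t * (t - h)) =
  J t - J (t - h) - h * g t by ring.
apply => c /andP[c1 c2]; apply: g_lip; first exact: le_trans c1.
  by apply: le_trans c2; exact: le_trans c1.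
by rewrite ler0_norm ?subr_le0//; lra.
Qed.

(** Telescoping [J] over the grid compares the two sums term by term, with an
    error [(C + G) * h ^+ 2] in each of the [N] terms. *)
Lemma averages_at_grid N : (0 < N)%N ->
  `|step_average N - time_average (N%:R * h)| <= (C + G) * h.
Proof.
move=> N0; have Nr : 0 < N%:R :> R by rewrite ltr0n.
have JE : J (N%:R * h) = \sum_(1 <= j < N.+1) (J (j%:R * h) - J (j.-1%:R * h)).
  rewrite big_add1 /= telescope_sumr//.
  by rewrite mul0r J0 subr0.
rewrite /step_average /time_average -mulrBr JE -sumrB normrM normfV.
have Nh : 0 < N%:R * h by rewrite mulr_gt0.
rewrite (gtr0_norm Nh) ler_pdivrMl//.
apply: le_trans (ler_norm_sum _ _ _) _.
have -> : N%:R * h * ((C + G) * h) =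
    \sum_(1 <= j < N.+1) (C * h ^+ 2 + G * h ^+ 2).
  by rewrite big_const_nat subn1 iter_addr_0 -mulr_natl; ring.
rewrite big_nat [leRHS]big_nat; apply: ler_sum => j /andP[j1 _].
have jE : j.-1%:R * h = j%:R * h - h.
  by rewrite -[in RHS](prednK j1) -[_.-1.+1]addn1 natrD mulrDl mul1r addrK.
have := primitive_step (t := j%:R * h); rewrite -jE => ps.
rewrite -(subrK (h * g (j%:R * h)) (theta j)) -addrA.
apply: le_trans (ler_normD _ _) _; apply: lerD; first exact: theta_close.
rewrite distrC; apply: ps; rewrite ler_peMl ?(ltW h0)// ler1n//.
Qed.

(** The average over [[0, T]] mixes the one over [[0, N h]] with the values on
    the remaining interval, whose weight is at most [h / T]. *)
Lemma averages_between N T : (0 < N)%N -> 1 <= T -> N%:R * h <= T ->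
  T <= N.+1%:R * h ->
  `|time_average T - time_average (N%:R * h)| <= 2 * L * h.
Proof.
move=> N0 T1 NT TN; have Nr : 0 < N%:R * h :> R by rewrite mulr_gt0// ltr0n.
have Th : T - N%:R * h <= h by move: TN; rewrite -natr1 mulrDl mul1r; lra.
have T0 : 0 < T by lra.
set s := N%:R * h in NT Nr Th *.
have -> : time_average T - time_average s =
    T^-1 * ((J T - J s) - (T - s) * (J s / s)).
  by rewrite /time_average; field; rewrite !gt_eqF.
have Jh : `|J T - J s| <= L * h.
  apply: le_trans (primitive_le (ltW Nr) NT) _; by rewrite ler_wpM2l.
have Js : `|J s / s| <= L.
  have := primitive_le (lexx 0) (ltW Nr); rewrite J0 !subr0 => Js.
  by rewrite normrM normfV (gtr0_norm Nr) ler_pdivrMr.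
have Jhs : `|(T - s) * (J s / s)| <= h * L.
  rewrite normrM ger0_norm ?subr_ge0// ler_pM// subr_ge0//.
rewrite normrM normfV (gtr0_norm T0) ler_pdivrMl//.
apply: (@le_trans _ _ (2 * L * h)).
  apply: le_trans (ler_normB _ _) _; lra.
by rewrite ler_peMl// !mulr_ge0// ltW.
Qed.

Lemma time_average_le T : 0 < T -> `|time_average T| <= L.
Proof.
move=> T0; have := primitive_le (lexx 0) (ltW T0); rewrite J0 !subr0 => JT.
by rewrite /time_average normrM normfV (gtr0_norm T0) ler_pdivrMl// mulrC.
Qed.

Lemma step_average_le N : (0 < N)%N -> `|step_average N| <= (C + G) * h + L.
Proof.
move=> N0; rewrite -(subrK (time_average (N%:R * h)) (step_average N)).
apply: le_trans (ler_normD _ _) _; apply: lerD; first exact: averages_at_grid.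
by apply: time_average_le; rewrite mulr_gt0// ltr0n.
Qed.

Lemma step_time_tail_close :
  tail_close \oo (pinfty_nbhs R) step_average time_average
    ((C + G + 2 * L) * h).
Proof.
move=> V [M [_ MV]].
exists [set N | (0 < N)%N /\ (Num.truncn (M / h) < N)%N] => [|N [N0 MN]].
  exists (Num.truncn (M / h)).+1 => // N /= MN.
  by split; rewrite // (leq_trans _ MN).
exists (N%:R * h).
  apply: MV; rewrite -ltr_pdivrMr//; apply: lt_le_trans (truncnS_gt _) _.
  by rewrite ler_nat.
apply: le_trans (averages_at_grid N0) _; rewrite ler_wpM2r// ?(ltW h0)//.
by rewrite lerDl mulr_ge0.
Qed.

Lemma time_step_tail_close :
  tail_close (pinfty_nbhs R) \oo time_average step_average
    ((C + G + 2 * L) * h).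
Proof.
move=> V [N0 _ NV].
(* The two extra steps absorb the rounding of [T / h] and keep [N] positive. *)
exists [set T | 1 <= T /\ N0.+2%:R * h <= T].
  exists (Num.max 1 (N0.+2%:R * h)); split; first exact: num_real.
  by move=> T; rewrite gt_max => /andP[T1 T2]; split; exact: ltW.
move=> T [T1 TN]; pose N := Num.truncn (T / h).
have T0 : 0 <= T / h by rewrite divr_ge0 ?(ltW h0)//; lra.
have /andP[NT TN1] := truncn_itv T0.
have NN0 : (N0.+1 < N.+1)%N.
  rewrite -(ltr_nat R); apply: le_lt_trans TN1.
  rewrite ler_pdivlMr//; apply: le_trans TN; rewrite ler_wpM2r ?(ltW h0)//.
  by rewrite ler_nat.
have N1 : (0 < N)%N by rewrite -ltnS; apply: leq_trans NN0.
exists N; first by apply: NV => /=; exact: ltnW.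
rewrite -(subrK (time_average (N%:R * h)) (time_average T)) -addrA.
have -> : (C + G + 2 * L) * h = 2 * L * h + (C + G) * h by ring.
apply: le_trans (ler_normD _ _) _; apply: lerD.
  apply: averages_between => //; first by rewrite -ler_pdivlMr.
  by rewrite -ler_pdivrMr// ltW.
by rewrite distrC; exact: averages_at_grid.
Qed.

End Averages.

(** * Comparison of the angular ranges *)

Lemma punctured_nneg0 {R : realType} : punctured_nneg (0 : R) = 0^'+.
Proof.
apply/funext => P; apply/propext; rewrite /punctured_nneg /at_right /within/=.
split=> -[e e0 eP]; exists e => // s se.
  by move=> s0; apply: (eP s se); [rewrite gt_eqF|exact: ltW].
by move=> s0 s1; apply: (eP s se); rewrite lt_def s0.
Qed.

Lemma has_tderiv_tderiv0 {R : realType} {V : normedModType R} (u : R -> V) l :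
  has_tderiv u 0 l -> tderiv u 0 = l.
Proof.
by rewrite /has_tderiv /tderiv punctured_nneg0 => ul; exact: cvg_lim.
Qed.

Section Solution.
Context {R : realType} {d : nat} (f : 'cV[R]_d -> 'cV[R]_d) (x : R -> 'cV[R]_d).
Hypotheses (f_C2 : class_C2 f) (x_sol : ode_solution f x).
Hypotheses (x_nonconstant : nonconstant_traj x) (x_bounded : bounded_traj x).

Let v t := f (x t).
Let A t := jac f (x t).
Let a t := A t *m v t.

(** A velocity that vanishes once vanishes at all times, forward and backward,
    since it solves a linear equation; the trajectory would be constant. *)
Lemma velocity_neq0 t : 0 <= t -> v t != 0.
Proof.
move=> t0; apply/eqP => vt; apply: x_nonconstant; exists (x 0) => s s0.
have [L _ AL] := generator_bounded x_bounded f_C2.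
have v0 r : 0 <= r -> v r = 0.
  move=> r0; apply/eqP; rewrite -eucl_norm_eq0 eq_le eucl_norm_ge0 andbT.
  have := eucl_gronwall (entry_deriv_velocity x_sol f_C2)
    (fun t t0 => AL t (v t) t0) r0 t0.
  by rewrite -/(v t) vt eucl_norm0 mulr0.
have := @entry_deriv_lip _ _ x v 0 s 0 (entry_deriv_traj x_sol) s0 (lexx 0).
rewrite mul0r => xs; apply/eqP; rewrite -subr_eq0 -eucl_norm_eq0.
rewrite eq_le eucl_norm_ge0 andbT; apply: xs => r r0 _.
by rewrite v0// eucl_norm0.
Qed.

(** Both sides solve the variational equation with the same initial value. *)
Lemma solution_operator_velocity (Phi : R -> R -> 'M[R]_d) :
  solution_operator A Phi -> forall t, 0 <= t -> Phi t 0 *m v 0 = v t.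
Proof.
move=> PhiA t t0; have [Phi0 dPhi] := PhiA 0 (lexx 0).
have [L _ AL] := generator_bounded x_bounded f_C2.
have du := entry_derivB (entry_deriv_mulmxl (v 0) (has_tderiv_entry dPhi))
  (entry_deriv_velocity x_sol f_C2).
have uL r : 0 <= r -> eucl_norm (A r *m Phi r 0 *m v 0 - A r *m v r) <=
    L * eucl_norm (Phi r 0 *m v 0 - v r).
  by move=> r0; rewrite -mulmxA -mulmxBr; exact: AL.
have := eucl_gronwall du uL t0 (lexx 0).
rewrite /= Phi0 mul1mx -/(v 0) subrr eucl_norm0 mulr0 => u0.
apply/eqP; rewrite -subr_eq0 -eucl_norm_eq0 eq_le eucl_norm_ge0 andbT.
exact: u0.
Qed.

(** The subspace transported by [Phi] is the line of the current velocity.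
    Clamping the time at [0] leaves the integral unchanged and makes the
    integrand continuous on the whole line. *)
Lemma alpha_cont_time_average (Phi : R -> R -> 'M[R]_d) (T : R) :
  solution_operator A Phi ->
  alpha_cont A Phi T <[v 0]>%VS =
  time_average
    (fun T => \int[lebesgue_measure]_(t in `[0, T])
      turning_speed v a (Num.max 0 t)) T.
Proof.
move=> PhiA; rewrite /alpha_cont /time_average; congr (_ * _).
apply: eq_Rintegral => t; rewrite inE/= in_itv/= => /andP[t0 _].
rewrite max_r// mximg_line solution_operator_velocity//.
by rewrite spectral_norm_line ?velocity_neq0.
Qed.

(** Every bound is relative to the current speed [|v t|], which may tend to zero
    as [t] grows. *)
Lemma trajectory_estimates : exists L K E : R,
  [/\ 0 <= L, 0 <= K & 0 <= E] /\
  [/\ forall t, 0 <= t -> eucl_norm (a t) <= L * eucl_norm (v t),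
      forall s t, 0 <= s -> 0 <= t -> `|s - t| <= 1 ->
        eucl_norm (v s) <= E * eucl_norm (v t)
    & forall s t, 0 <= s -> 0 <= t -> `|s - t| <= 1 ->
        eucl_norm (a s - a t) <= K * `|s - t| * eucl_norm (v t)].
Proof.
have [L L0 AL] := generator_bounded x_bounded f_C2.
have [K K0 AK] := generator_lipschitz x_sol x_bounded f_C2.
pose E := expR L; have E0 : 0 <= E := expR_ge0 L.
have aL t : 0 <= t -> eucl_norm (a t) <= L * eucl_norm (v t) by exact: AL.
have dv : entry_deriv v a by exact: entry_deriv_velocity.
have vE s t : 0 <= s -> 0 <= t -> `|s - t| <= 1 ->
    eucl_norm (v s) <= E * eucl_norm (v t).
  move=> s0 t0 st; apply: le_trans (eucl_gronwall dv aL s0 t0) _.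
  by rewrite ler_wpM2r ?eucl_norm_ge0// ler_expR ler_piMr.
exists L, (K * E + L * (L * E)), E; split.
  by split=> //; rewrite addr_ge0// !mulr_ge0.
split=> // s t s0 t0 st.
have -> : a s - a t = (A s - A t) *m v s + A t *m (v s - v t).
  by rewrite mulmxBl mulmxBr addrA subrK.
apply: le_trans (ler_eucl_normD _ _) _; rewrite !mulrDl; apply: lerD.
  apply: le_trans (AK _ _ _ s0 t0) _.
  have -> : K * E * `|s - t| * eucl_norm (v t) =
    K * `|s - t| * (E * eucl_norm (v t)) by ring.
  by rewrite ler_wpM2l ?vE// mulr_ge0.
apply: le_trans (AL _ _ t0) _; rewrite -!mulrA ler_wpM2l//.
by have := velocity_taylor0 L0 dv aL vE s0 t0 st; rewrite -!mulrA.
Qed.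

End Solution.

Lemma continuous_clamped {R : realType} (g : R -> R) (G e : R) :
  0 < e -> 0 <= G ->
  (forall s t, 0 <= s -> 0 <= t -> `|s - t| <= e ->
    `|g s - g t| <= G * `|s - t|) ->
  continuous (fun t : R => g (Num.max 0 t)).
Proof.
move=> e0 G0 gl t; apply/cvgrPdist_le => /= eps eps0.
have m0 (s : R) : 0 <= Num.max 0 s by rewrite le_max lexx.
have lipm (s r : R) : `|Num.max 0 s - Num.max 0 r| <= `|s - r|.
  case: (leP 0 s) => hs; case: (leP 0 r) => hr.
  - by [].
  - rewrite subr0 !ger0_norm//; last by lra.
    by rewrite lerBrDr; lra.
  - by rewrite sub0r normrN distrC !ger0_norm//; lra.
  - by rewrite subrr normr0.
have eps1 : 0 < eps / (G + 1) by rewrite divr_gt0//; lra.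
near=> s.
have ts : `|t - s| <= e.
  by near: s; apply: cvgr_dist_le => //; exact: cvg_id.
have ts' : `|t - s| <= eps / (G + 1).
  by near: s; apply: cvgr_dist_le => //; exact: cvg_id.
apply: le_trans (gl _ _ (m0 t) (m0 s) (le_trans (lipm t s) ts)) _.
have h1 : G * `|Num.max 0 t - Num.max 0 s| <= G * (eps / (G + 1)).
  by rewrite ler_wpM2l// (le_trans (lipm t s)).
apply: le_trans h1 _; rewrite mulrCA ler_piMr ?(ltW eps0)//.
by rewrite ler_pdivrMr; lra.
Unshelve. all: by end_near. Qed.

Unset Implicit Arguments.

Theorem theorem4p10 (R : realType) (d : nat)
    (f : 'cV[R]_d -> 'cV[R]_d) (x : R -> 'cV[R]_d)
    (A : R -> 'M[R]_d) (Phi : R -> R -> 'M[R]_d) (V0 : {vspace 'cV[R]_d})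
    (f_C2 : class_C2 f)
    (x_sol : ode_solution f x)
    (x_nonconstant : nonconstant_traj x)
    (x_bounded : bounded_traj x)
    (A_def : A = fun t => jac f (x t))
    (Phi_sol : solution_operator A Phi)
    (V0_def : V0 = <[tderiv x 0]>%VS) :
  exists C h0 : R, 0 < C /\ 0 < h0 /\
    forall h : R, 0 < h -> h <= h0 ->
      (hausdorff_dist (range_diff x h) (range_cont A Phi V0) <= (C * h)%:E)%E.
Proof.
have x0' : tderiv x 0 = f (x 0) by apply: has_tderiv_tderiv0; exact: x_sol.
rewrite x0' in V0_def; subst A V0.
have [L [K [E [[L0 K0 E0] [aL vE aK]]]]] :=
  trajectory_estimates f_C2 x_sol x_bounded.
set v := fun t => f (x t) in aL vE aK.
set a := fun t => jac f (x t) *m f (x t) in aL aK.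
have dx : entry_deriv x v by exact: entry_deriv_traj.
have dv : entry_deriv v a by exact: entry_deriv_velocity.
have v_neq0 := velocity_neq0 f_C2 x_sol x_nonconstant x_bounded.
pose g t := turning_speed v a (Num.max 0 t).
pose J T := \int[lebesgue_measure]_(t in `[0, T]) g t.
pose G := 2 * K + 6 * L * (L * E).
pose C1 := 4 * K + 6 * L * (L * E).
pose C2 := C1 + 2 * (L + C1) ^+ 2.
have LE0 : 0 <= L * E by rewrite mulr_ge0.
have G0 : 0 <= G by rewrite addr_ge0 ?mulr_ge0.
have C20 : 0 <= C2.
  have C10 : 0 <= C1 by rewrite addr_ge0 ?mulr_ge0.
  by rewrite /C2 addr_ge0// mulr_ge0// sqr_ge0.
(* Below [h0] the velocity changes by at most half its norm within a step. *)
pose h0 := 1 / (2 * (L * E + 1)).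
have h0_gt0 : 0 < h0 by rewrite divr_gt0//; lra.
have h0_le1 : h0 <= 1 by rewrite ler_pdivrMr; lra.
have LEh h : h <= h0 -> L * E * h <= 1 / 2.
  move=> hh0; apply: (@le_trans _ _ (L * E * h0)); first by rewrite ler_wpM2l.
  by rewrite mulrA ler_pdivrMr; lra.
have g_lip s t : 0 <= s -> 0 <= t -> `|s - t| <= h0 ->
    `|turning_speed v a s - turning_speed v a t| <= G * `|s - t|.
  move=> s0 t0 st; apply: (turning_speed_lip L0 E0 dv) => //.
    exact: le_trans st h0_le1.
  exact: LEh.
have cg : continuous g by exact: (continuous_clamped h0_gt0 G0 g_lip).
have dJ : half_deriv J g by exact: half_deriv_integral.
have J0 : J 0 = 0 by rewrite /J set_itv1 Rintegral_set1.
have g_le t : 0 <= t -> `|g t| <= L.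
  move=> t0; rewrite /g max_r//.
  have /andP[g0 gL] := turning_speed_bounds v_neq0 aL t0.
  by rewrite ger0_norm.
(* The summand [1] makes the constant positive. *)
exists (C2 + G + 2 * L + 1), h0; split; first by lra.
split=> // h hpos hh0.
pose theta j := angle (x (j.-1%:R * h) - x (j%:R * h))
                      (x (j%:R * h) - x (j.+1%:R * h)).
have gh_lip s t : 0 <= s -> 0 <= t -> `|s - t| <= h -> `|g s - g t| <= G * h.
  move=> s0 t0 st; rewrite /g !max_r//.
  apply: le_trans (g_lip _ _ s0 t0 (le_trans st hh0)) _.
  by rewrite ler_wpM2l.
have theta_close j : (0 < j)%N -> `|theta j - h * g (j%:R * h)| <= C2 * h ^+ 2.
  move=> j0; have jh : h <= j%:R * h by rewrite ler_peMl ?(ltW hpos)// ler1n.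
  rewrite /theta /g max_r; last by lra.
  have -> : j.-1%:R * h = j%:R * h - h.
    by rewrite -[in RHS](prednK j0) -[_.-1.+1]addn1 natrD mulrDl mul1r addrK.
  have -> : j.+1%:R * h = j%:R * h + h by rewrite -natr1 mulrDl mul1r.
  apply: (angle_step L0 K0 E0 dx dv v_neq0 aL vE aK) => //.
    exact: le_trans hh0 h0_le1.
  exact: LEh.
have -> : range_cont (fun t => jac f (x t)) Phi <[f (x 0)%R]>%VS =
    [set y : R | (limf_einf (fun T => (time_average J T)%:E) +oo%R <= y%:E)%E /\
                 (y%:E <= limf_esup (fun T => (time_average J T)%:E) +oo%R)%E].
  rewrite /range_cont.
  have -> // : (fun T : R => (alpha_cont (fun t => jac f (x t)) Phi T
      <[f (x 0)%R]>%VS)%:E) = (fun T => (time_average J T)%:E).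
  apply/funext => T; congr EFin; exact: alpha_cont_time_average.
apply: (@le_trans _ _ ((C2 + G + 2 * L) * h)%:E); last first.
  by rewrite lee_fin ler_wpM2r ?(ltW hpos)//; lra.
apply: (@hausdorff_dist_limit_ranges _ _ _ \oo (pinfty_nbhs R)
  (step_average theta h) (time_average J) _ ((C2 + G) * h + L)).
- by rewrite mulr_ge0 ?(ltW hpos)//; lra.
- exists 1%N => // N /= N1.
  exact: (step_average_le hpos dJ J0 g_le gh_lip theta_close).
- exists 1; split; first exact: num_real.
  move=> T T1; have T0 : 0 < T by lra.
  apply: le_trans (time_average_le dJ J0 g_le T0) _.
  by rewrite lerDr mulr_ge0 ?(ltW hpos)//; lra.
- exact: (step_time_tail_close L0 hpos dJ J0 gh_lip theta_close).
- exact: (time_step_tail_close L0 hpos dJ J0 g_le gh_lip theta_close).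
Qed.
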